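(* Let $T'$ be the tree on $14$ vertices obtained from a path $x_1x_2x_3x_4$ by attaching three pendant leaves to each of $x_1$ and $x_4$ and two pendant leaves to each of $x_2$ and $x_3$ (so that $x_1,x_2,x_3,x_4$ all have degree $4$). Then Bob can win the $3$-Expanded Coloring Game on the uncolored tree $T'$. Moreover, $T'$ is a minimal example of a tree with game chromatic number $4$: $\chi_{\mathrm{g}}(T')=4$, and every forest with fewer vertices has game chromatic number at most $3$.
   Context: A color is legal for an uncolored vertex $v$ if no neighbor of $v$ has that color. The $t$-coloring game on a (partially colored) graph with $t$ colors: Alice and Bob alternate turns, Alice first, each coloring an uncolored vertex with a legal color; Bob wins if at some point an uncolored vertex has no legal color, Alice wins if all vertices become colored. $\chi_{\mathrm{g}}(G)$ is the least $t$ such that Alice has a winning strategy in the $t$-coloring game on the uncolored graph $G$. The $k$-Expanded Coloring Game ($k$-ECG) on a partially colored forest is the same as the $k$-coloring game except that on her turn Alice may choose not to color a vertex, and if she does not color a vertex she may instead add to the forest a single new colored leaf (a new vertex joined to exactly one existing vertex, colored with one of the $k$ colors). *)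

(* Defs.v *)
From mathcomp Require Import all_boot.
Set Implicit Arguments. Unset Strict Implicit. Unset Printing Implicit Defensive.

(* A finite graph with vertex set {0,..,gn-1}; gadj is only meaningful on it. *)
Record graph := Graph { gn : nat; gadj : nat -> nat -> bool }.

Definition is_forest (G : graph) : Prop :=
  (forall x y, x < gn G -> y < gn G -> gadj G x y = gadj G y x) /\
  (forall x, x < gn G -> gadj G x x = false) /\
  ~ (exists s : seq nat, [/\ 3 <= size s, uniq s,
                             all (fun v => v < gn G) s & cycle (gadj G) s]).

Record pos := Pos { pg : graph; col : nat -> option nat }.

Definition uncolored (G : graph) : pos := Pos G (fun _ => None).

Definition legal (k : nat) (P : pos) (v c : nat) : Prop :=
  c < k /\ forall u, u < gn (pg P) -> gadj (pg P) v u -> col P u <> Some c.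

Definition all_colored (P : pos) : Prop :=
  forall v, v < gn (pg P) -> col P v <> None.

Definition stuck (k : nat) (P : pos) : Prop :=
  exists v, [/\ v < gn (pg P), col P v = None & forall c, ~ legal k P v c].

Definition set_col (P : pos) (v c : nat) : pos :=
  Pos (pg P) (fun x => if x == v then Some c else col P x).

Definition color_move (k : nat) (P P' : pos) : Prop :=
  exists v c, [/\ v < gn (pg P), col P v = None, legal k P v c & P' = set_col P v c].

Definition add_leaf (P : pos) (v c : nat) : pos :=
  let n := gn (pg P) in
  Pos (Graph n.+1 (fun x y => [&& x < n, y < n & gadj (pg P) x y]
                               || ((x == n) && (y == v)) || ((x == v) && (y == n))))
      (fun x => if x == n then Some c else col P x).

Definition ecg_alice_move (k : nat) (P P' : pos) : Prop :=
  color_move k P P' \/ P' = P \/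
  exists v c, [/\ v < gn (pg P), c < k & P' = add_leaf P v c].

(* Bob has a winning strategy in the k-ECG from position P;
   the bool is true iff it is Alice's turn.  Inductive: Bob forces a win
   in finitely many moves. *)
Inductive bob_wins_ecg (k : nat) : pos -> bool -> Prop :=
| bwe_stuck P t : stuck k P -> bob_wins_ecg k P t
| bwe_alice P : ~ all_colored P ->
    (forall P', ecg_alice_move k P P' -> bob_wins_ecg k P' false) ->
    bob_wins_ecg k P true
| bwe_bob P P' : ~ all_colored P -> color_move k P P' ->
    bob_wins_ecg k P' true -> bob_wins_ecg k P false.

(* Alice has a winning strategy in the ordinary k-coloring game from P
   (bool true iff Alice to move). The game is finite. *)
Inductive alice_wins (k : nat) : pos -> bool -> Prop :=
| aw_done P t : all_colored P -> alice_wins k P t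
| aw_alice P P' : ~ stuck k P -> color_move k P P' ->
    alice_wins k P' false -> alice_wins k P true
| aw_bob P : ~ stuck k P ->
    (forall P', color_move k P P' -> alice_wins k P' true) ->
    alice_wins k P false.

Definition alice_wins_game (t : nat) (G : graph) : Prop :=
  alice_wins t (uncolored G) true.

Definition game_chromatic_eq (G : graph) (t : nat) : Prop :=
  alice_wins_game t G /\ forall s, s < t -> ~ alice_wins_game s G.

Definition game_chromatic_le (G : graph) (t : nat) : Prop :=
  exists s, s <= t /\ alice_wins_game s G.

(* The tree T': path x1x2x3x4 = 0-1-2-3; leaves 4,5,6 on 0; 7,8,9 on 3;
   10,11 on 1; 12,13 on 2. *)
Definition Tprime_edges : seq (nat * nat) :=
  [:: (0,1); (1,2); (2,3); (0,4); (0,5); (0,6); (3,7); (3,8); (3,9);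
      (1,10); (1,11); (2,12); (2,13)].

Definition Tprime : graph :=
  Graph 14 (fun x y => ((x, y) \in Tprime_edges) || ((y, x) \in Tprime_edges)).

(* Main.v *)
(* Alice.  With k colors, call an uncolored vertex dangerous if the number of
   colors it sees plus the number of its uncolored neighbors is at least k; the
   other uncolored vertices can never get stuck.  On a forest Alice keeps, after
   each of her moves, every component of the uncolored part down to at most two
   dangerous vertices, which together see at most one color, and if they are
   adjacent one of them can be made safe by a single further move; she always
   answers in the component where Bob has just played.  A forest with n < 14
   vertices, m of degree at least 3 and h of degree at least 4 satisfies
   2m + h <= n - 2 <= 11, so two disjoint parts cannot both contain three vertices
   of the first kind or two of the second; hence some centroid-like vertex
   separates the forest into parts containing neither, and Alice opens there.

   Bob.  On Tprime only the four spine vertices matter.  A position is abstracted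
   to the colors of the spine, the colors each spine vertex sees outside the spine,
   and the number of leaves there that Bob can still color freely; Bob's win in this
   finite game is found by a verified search. *)

Require Import Defs.
From mathcomp Require Import all_boot zify.
Set Implicit Arguments. Unset Strict Implicit. Unset Printing Implicit Defensive.

(** * Alice's invariant *)

Definition upd (f : nat -> option nat) (v c : nat) : nat -> option nat :=
  fun x => if x == v then Some c else f x.

Section Strategy.
Variables (n k : nat) (adj : nat -> nat -> bool).
Hypothesis k_gt2 : 2 < k.
Hypothesis adj_sym : forall x y : 'I_n, adj x y = adj y x.
Hypothesis no_triangle : forall x y z : 'I_n, adj x y -> adj y z -> adj x z -> False.
Hypothesis no_square : forall x y z t : 'I_n,
  adj x y -> adj y z -> adj z t -> adj t x -> x != z -> y != t -> False.

Implicit Types (f : nat -> option nat) (x y z t u v d r : 'I_n) (c : 'I_k).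

Definition seen f d : {set 'I_k} :=
  [set c | [exists u : 'I_n, adj d u && (f u == Some (val c))]].
Definition free f d : {set 'I_n} := [set u : 'I_n | adj d u && (f u == None)].
(** An upper bound for the number of colors that [d] can ever see, since each free neighbor
    contributes at most one more. *)
Definition pot f d := #|seen f d| + #|free f d|.
Definition danger f : {set 'I_n} := [set d : 'I_n | (f d == None) && (k <= pot f d)].
Definition uncol_adj f : rel 'I_n :=
  fun x y => [&& adj x y, f x == None & f y == None].
Definition conn f := connect (uncol_adj f).

Lemma seenP f d c :
  reflect (exists2 u : 'I_n, adj d u & f u = Some (val c)) (c \in seen f d).
Proof.
rewrite inE; apply: (iffP existsP) => [[u /andP[a /eqP b]]|[u a b]]; exists u => //.
by rewrite a b eqxx.
Qed.

Lemma conn_sym f x y : conn f x y = conn f y x.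
Proof.
rewrite /conn; apply: (sym_connect_sym (e := uncol_adj f)) => {}x {}y.
by rewrite /uncol_adj adj_sym [(f x == None) && _]andbC.
Qed.

Lemma conn1 f x y : adj x y -> f x = None -> f y = None -> conn f x y.
Proof. by move=> a b c; apply: connect1; rewrite /uncol_adj a b c. Qed.

Lemma conn_trans f x y z : conn f x y -> conn f y z -> conn f x z.
Proof. exact: connect_trans. Qed.

Definition extends f f' := forall x, f x <> None -> f' x = f x.

Lemma extends_upd f v c : f v = None -> extends f (upd f v c).
Proof. by move=> fv x fx; rewrite /upd; case: eqP => // /val_inj e; rewrite e fv in fx. Qed.

Lemma extends_trans f g h : extends f g -> extends g h -> extends f h.
Proof. by move=> fg gh x fx; rewrite gh fg. Qed.

Lemma extends_None f f' x : extends f f' -> f' x = None -> f x = None.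
Proof. by move=> ex; case E: (f x) => // <-; rewrite ex E. Qed.

Lemma conn_extends f f' x y : extends f f' -> conn f' x y -> conn f x y.
Proof.
move=> ex; apply: connect_sub => {}x {}y /and3P[a /eqP b /eqP c].
by apply: conn1 => //; apply: extends_None ex _.
Qed.

(** A newly seen color sits on a neighbor that was free and no longer is, so every gain in [seen] is
    paid for by a loss in [free]. *)
Lemma pot_extends f f' d : extends f f' -> pot f' d <= pot f d.
Proof.
move=> ex; rewrite /pot.
(* [g] reads a color as an element of ['I_k]. Its default, color 0, is harmless because only an
   inclusion into the image is claimed. *)
pose g u : 'I_k := odflt (Ordinal (ltnW (ltnW k_gt2))) (insub (odflt 0 (f' u))).
have sub : seen f' d \subset seen f d :|: g @: (free f d :\: free f' d).
  apply/subsetP => c /seenP[u a b]; rewrite inE.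
  case E: (f u) => [c'|].
    by apply/orP; left; apply/seenP; exists u => //; rewrite -b ex // E.
  apply/orP; right; apply/imsetP; exists u; first by rewrite !inE a b E.
  by rewrite /g b /= valK.
have sub2 : free f' d \subset free f d.
  apply/subsetP => u; rewrite !inE => /andP[-> /eqP b].
  by rewrite (extends_None ex b).
have le1 : #|seen f' d| <= #|seen f d| + #|free f d :\: free f' d|.
  apply: leq_trans (subset_leq_card sub) _; apply: leq_trans (leq_card_setU _ _) _.
  by rewrite leq_add2l leq_imset_card.
move: le1 (subset_leq_card sub2); rewrite cardsD (setIidPr sub2); lia.
Qed.

Lemma danger_extends f f' d : extends f f' -> d \in danger f' -> d \in danger f.
Proof.
move=> ex; rewrite !inE => /andP[/eqP a b].
by rewrite (extends_None ex a) eqxx (leq_trans b) ?pot_extends.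
Qed.

Lemma danger_None f d : d \in danger f -> f d = None.
Proof. by rewrite inE => /andP[/eqP]. Qed.

Lemma eq_seen f f' d : (forall u, adj d u -> f' u = f u) -> seen f' d = seen f d.
Proof.
move=> E; apply/setP => c; apply/seenP/seenP => -[u a b]; exists u => //.
  by rewrite -E.
by rewrite E.
Qed.

Lemma eq_free f f' d : (forall u, adj d u -> f' u = f u) -> free f' d = free f d.
Proof.
by move=> E; apply/setP => u; rewrite !inE; case a: (adj d u) => //=; rewrite E.
Qed.

Lemma seen_upd_nadj f v c d : ~~ adj d v -> seen (upd f v c) d = seen f d.
Proof.
move=> a; apply: eq_seen => u b; rewrite /upd; case: eqP => // /val_inj E.
by rewrite E (negPf a) in b.
Qed.

Lemma seen_upd f v c d : seen (upd f v c) d \subset c |: seen f d.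
Proof.
apply/subsetP => c' /seenP[u a]; rewrite /upd; case: eqP => _ b.
  by rewrite !inE (val_inj (Some_inj b)) eqxx.
by rewrite inE; apply/orP; right; apply/seenP; exists u.
Qed.

Lemma card_seen_upd f v c d : #|seen (upd f v c) d| <= #|seen f d|.+1.
Proof.
apply: leq_trans (subset_leq_card (seen_upd f v c d)) _.
by rewrite cardsU1; case: (_ \notin _).
Qed.

Lemma exists_unseen f d : #|seen f d| < k -> exists c, c \notin seen f d.
Proof.
move=> lt; have /card_gt0P[c cP] : 0 < #|~: seen f d|.
  by have := cardsC (seen f d); rewrite card_ord; lia.
by exists c; rewrite inE in cP.
Qed.

Lemma card_seen_safe f d : f d = None -> d \notin danger f -> #|seen f d| < k.
Proof. by rewrite inE => -> /=; rewrite -ltnNge; apply: leq_ltn_trans (leq_addr _ _). Qed.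

(* [inv_leaf] makes it legal to give the last free neighbor [t] of [x] the color
   that [x] and [y] already see. *)
Record Inv f : Prop := MkInv {
  inv_seen : forall x, x \in danger f -> #|seen f x| <= k - 2;
  inv_two : forall x y z, x \in danger f -> y \in danger f -> z \in danger f ->
    conn f x y -> conn f x z -> [\/ x = y, x = z | y = z];
  inv_pair : forall x y, x \in danger f -> y \in danger f -> x != y ->
    conn f x y -> #|seen f x| + #|seen f y| <= 1;
  inv_pot : forall x y, x \in danger f -> y \in danger f -> adj x y ->
    pot f x <= 3 \/ pot f y <= 3;
  inv_leaf : forall x y t c, x \in danger f -> y \in danger f -> adj x y ->
    t \in free f x -> t != y -> c \in seen f x :|: seen f y -> c \notin seen f t }.

(** All changes lie in the component of [r], so dangerous vertices elsewhere keep their seen colors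
    and free neighbors. In that component at most one dangerous vertex is left, which makes the
    clauses about pairs vacuous there. *)
Lemma Inv_step f f' r : Inv f -> extends f f' ->
  (forall x, f' x <> f x -> conn f r x) ->
  (forall x y, x \in danger f' -> y \in danger f' ->
     conn f r x -> conn f r y -> x = y) ->
  (forall x, x \in danger f' -> conn f r x -> #|seen f' x| <= k - 2) ->
  Inv f'.
Proof.
move=> I ex loc one few.
have D x : x \in danger f' -> x \in danger f by apply: danger_extends.
have far x u : ~~ conn f r x -> f x = None -> adj x u -> f' u = f u.
  move=> nc fx a; case E: (f u) => [c|]; first by rewrite ex E.
  case E': (f' u) => [c|] //; case/negP: nc.
  have cu : conn f r u by apply: loc; rewrite E E'.
  by apply: conn_trans cu _; rewrite conn_sym; apply: conn1.
have farS x : ~~ conn f r x -> f x = None -> seen f' x = seen f x.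
  by move=> nc fx; apply: eq_seen => u; apply: far.
have pair x y : x \in danger f' -> y \in danger f' -> x != y -> conn f x y ->
    ~~ conn f r x /\ ~~ conn f r y.
  move=> dx dy xy cxy.
  have E : conn f r x = conn f r y.
    apply/idP/idP => h; apply: conn_trans h _ => //; by rewrite conn_sym.
  suff: ~~ conn f r x by rewrite -E.
  by apply/negP => h; case/eqP: xy; apply: one => //; rewrite -E.
have adjN x y : x \in danger f' -> y \in danger f' -> adj x y ->
    (x != y /\ conn f x y).
  move=> dx dy a; split; last by apply: conn1 => //; apply: danger_None; apply: D.
  by apply/eqP => E; apply: (no_triangle (x := x) (y := y) (z := x)); rewrite E in a *.
split.
- move=> x dx; have [h|h] := boolP (conn f r x); first exact: few.
  by rewrite farS //; [apply: inv_seen I _ (D _ dx)|apply: danger_None; apply: D].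
- move=> x y z dx dy dz cy cz.
  by apply: (inv_two I); try exact: D; exact: conn_extends ex _.
- move=> x y dx dy xy cxy; have {}cxy := conn_extends ex cxy.
  have [nx ny] := pair _ _ dx dy xy cxy.
  rewrite !farS //; try by apply: danger_None; apply: D.
  by apply: (inv_pair I) => //; apply: D.
- move=> x y dx dy a.
  by case: (inv_pot I (D _ dx) (D _ dy) a) => h; [left|right];
     apply: leq_trans h; apply: pot_extends.
- move=> x y t c dx dy a.
  have [xy cxy] := adjN _ _ dx dy a.
  have [nx ny] := pair _ _ dx dy xy cxy.
  have fx := danger_None (D _ dx); have fy := danger_None (D _ dy).
  have Ef : free f' x = free f x by apply: eq_free => u; apply: far.
  rewrite (farS x) // (farS y) // Ef => tx ty cc.
  have := tx; rewrite inE => /andP[xt /eqP ft].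
  rewrite farS //; first exact: (inv_leaf I (D _ dx) (D _ dy) a tx).
  by apply: contra nx => h; apply: conn_trans h _; rewrite conn_sym; apply: conn1.
Qed.

(* Alice's move when Bob's move left the invariant intact. *)
Lemma tempo f : Inv f -> (exists v, f v = None) ->
  exists x c, [/\ f x = None, c \notin seen f x & Inv (upd f x c)].
Proof.
move=> I [v fv].
have upd_loc x c : f x = None -> forall y, upd f x c y <> f y -> conn f x y.
  by move=> fx y; rewrite /upd; case: eqP => // /val_inj -> _; apply: connect0.
have updD x c y : y \in danger (upd f x c) -> y != x.
  by apply: contraL => /eqP ->; rewrite inE /upd eqxx.
have [D0|[x0 dx0]] := set_0Vmem (danger f).
  have [c cP] : exists c, c \notin seen f v.
    by apply/exists_unseen/card_seen_safe; rewrite ?D0 ?inE.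
  exists v, c; split => //; apply: (Inv_step (r := v) I).
  - exact: extends_upd.
  - exact: upd_loc.
  - by move=> x y /(danger_extends (extends_upd c fv)); rewrite D0 inE.
  - by move=> x /(danger_extends (extends_upd c fv)); rewrite D0 inE.
(* Coloring [x] leaves at most its partner dangerous in the component. A partner that saw nothing
   now sees at most one color, and 1 <= k - 2. *)
have reply x : x \in danger f ->
    (forall y, y \in danger f -> y != x -> conn f x y -> seen f y = set0) ->
    exists x c, [/\ f x = None, c \notin seen f x & Inv (upd f x c)].
  move=> dx oth; have fx := danger_None dx.
  have [c cP] : exists c, c \notin seen f x.
    by apply: exists_unseen; apply: leq_ltn_trans (inv_seen I dx) _; lia.
  have ex := extends_upd c fx.
  exists x, c; split => //; apply: (Inv_step (r := x) I) => //.
  - exact: upd_loc.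
  - move=> y z dy dz cy cz.
    case: (inv_two I dx (danger_extends ex dy) (danger_extends ex dz) cy cz) => // E.
      by have := updD _ _ _ dy; rewrite E eqxx.
    by have := updD _ _ _ dz; rewrite E eqxx.
  - move=> y dy cy; apply: leq_trans (card_seen_upd f x c y) _.
    by rewrite (oth y) ?cards0; try lia; [exact: danger_extends ex dy|exact: updD dy].
(* By [inv_pair] at most one of the two partners sees a color; if one does, that one gets
   colored. *)
have [[y [dy yx cy sy]]|no] : (exists y, [/\ y \in danger f, y != x0, conn f x0 y & seen f y != set0]) \/
    (forall y, y \in danger f -> y != x0 -> conn f x0 y -> seen f y = set0).
  have [/existsP[y /and4P[? ? ? ?]]|no] := boolP [exists y, [&& y \in danger f, y != x0, conn f x0 y & seen f y != set0]].
    by left; exists y.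
  right => y a b c; apply/eqP; apply: contraNT no => h; apply/existsP; exists y.
  by rewrite a b c.
- apply: (reply y dy) => z dz zy cz.
  have := inv_pair I dy dz; rewrite eq_sym zy cz => /(_ isT isT).
  have : 0 < #|seen f y| by rewrite card_gt0.
  by move=> p q; apply: cards0_eq; lia.
- exact: (reply x0 dx0).
Qed.

(** Alice's answer to Bob's coloring of [u] with [c0]. If no dangerous vertex is left around [u],
    she plays a tempo move; a single one she colors. If two are left, she must dispose of one while
    the other keeps seeing at most one color. *)
Lemma reply f u c0 : Inv f -> f u = None ->
  (exists v, upd f u c0 v = None) ->
  exists x c, [/\ upd f u c0 x = None, c \notin seen (upd f u c0) x
                & Inv (upd (upd f u c0) x c)].
Proof.
move=> I fu; set g := upd f u c0 => ng.
have ex : extends f g by apply: extends_upd.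
have D x : x \in danger g -> x \in danger f by apply: danger_extends.
have gu x : g x = None -> x != u by apply: contra_eq_neq => ->; rewrite /g /upd eqxx.
have guD x : x \in danger g -> x != u by move/danger_None/gu.
have sg x : x \in danger f -> #|seen g x| < k.
  move=> dx; apply: leq_ltn_trans (card_seen_upd _ _ _ _) _.
  have := inv_seen I dx; lia.
have finish x c : g x = None -> conn f u x -> c \notin seen g x ->
    (forall y z, y \in danger (upd g x c) -> z \in danger (upd g x c) ->
       conn f u y -> conn f u z -> y = z) ->
    (forall y, y \in danger (upd g x c) -> conn f u y ->
       #|seen (upd g x c) y| <= k - 2) ->
    exists x c, [/\ g x = None, c \notin seen g x & Inv (upd g x c)].
  move=> gx cx cP one few; exists x, c; split => //.
  apply: (Inv_step (r := u) I) => //.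
    by apply: extends_trans ex _; apply: extends_upd.
  move=> y; rewrite /upd; case: eqP => [/val_inj -> //|_].
  by rewrite /g /upd; case: eqP => // /val_inj -> _; apply: connect0.
have updD x c y : y \in danger (upd g x c) -> y != x.
  by apply: contraL => /eqP ->; rewrite inE /upd eqxx.
have [/existsP[d /andP[dd cd]]|K0] := boolP [exists d, (d \in danger g) && conn f u d]; last first.
  apply: tempo => //; apply: (Inv_step (r := u) I) => //.
  - move=> y; rewrite /g /upd; case: eqP => // /val_inj -> _; exact: connect0.
  - by move=> x y dx _ cx; case/existsP: K0; exists x; rewrite dx.
  - by move=> x dx cx; case/existsP: K0; exists x; rewrite dx.
have [/existsP[y /and3P[dy cy dny]]|K1] :=
    boolP [exists y, [&& y \in danger g, conn f u y & d != y]]; last first.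
  have [c cP] := exists_unseen (sg _ (D _ dd)).
  have gd := danger_None dd.
  have only z : z \in danger (upd g d c) -> conn f u z -> False.
    move=> dz cz; case/existsP: K1; exists z.
    by rewrite cz (danger_extends (extends_upd _ gd) dz) eq_sym (updD _ _ _ dz).
  by apply: (finish d c) => //; [move=> x z dx _ /only|move=> x dx /only]; case/(_ dx).
have color x z c : x \in danger g -> z \in danger g -> x != z ->
    conn f u x -> conn f u z -> c \notin seen g x ->
    #|seen (upd g x c) z| <= 1 ->
    exists x c, [/\ g x = None, c \notin seen g x & Inv (upd g x c)].
  move=> dx dz xz cx cz cP few; have gx := danger_None dx.
  have only w : w \in danger (upd g x c) -> conn f u w -> w = z.
    move=> dw cw; have dw' := danger_extends (extends_upd _ gx) dw.
    case: (inv_two I (D _ dx) (D _ dz) (D _ dw')).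
    - by apply: conn_trans cz; rewrite conn_sym.
    - by apply: conn_trans cw; rewrite conn_sym.
    - by move/eqP: xz.
    - by move=> E; have := updD _ _ _ dw; rewrite E eqxx.
    - by [].
  apply: (finish x c) => // [w w' dw dw' cw cw'|w dw cw].
    by rewrite (only w) // (only w').
  by rewrite (only w) //; apply: leq_trans few _; rewrite subn_gt0.
have sum1 : #|seen f d| + #|seen f y| <= 1.
  by apply: (inv_pair I) => //; try exact: D; apply: conn_trans cy; rewrite conn_sym.
have [a|na] := boolP (adj d y); last first.
  (* Coloring [x] does not show in [z]. The two saw at most one color together before Bob's move, so
     one of them still sees at most one and can play the role of [z]. *)
  have nonadj x z : x \in danger g -> z \in danger g -> x != z ->
      conn f u x -> conn f u z -> ~~ adj x z -> #|seen g z| <= 1 ->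
      exists x c, [/\ g x = None, c \notin seen g x & Inv (upd g x c)].
    move=> dx dz xz cx cz nxz few.
    have [c cP] := exists_unseen (sg _ (D _ dx)).
    by apply: (color x z c) => //; rewrite seen_upd_nadj // adj_sym.
  have [few|many] := leqP #|seen g y| 1; first exact: (nonadj d y).
  apply: (nonadj y d) => //; rewrite 1?eq_sym 1?adj_sym //.
  by move: many; have := card_seen_upd f u c0 d; have := card_seen_upd f u c0 y; rewrite -/g; lia.
(* If one endpoint still sees nothing, coloring the other is enough. Otherwise Bob played next to
   the endpoint that saw nothing, so it now sees exactly [c0], while the other, by absence of
   triangles, still sees one old color [b]. *)
have adjacent x z : x \in danger g -> z \in danger g -> x != z ->
    conn f u x -> conn f u z -> adj x z -> #|seen f z| = 0 -> #|seen f x| <= 1 ->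
    exists x c, [/\ g x = None, c \notin seen g x & Inv (upd g x c)].
  move: x z => {dd cd dy cy dny sum1 a} {}d {}y dd dy dny cd cy a sy sd.
  have fy : seen f y = set0 by apply: cards0_eq.
  have gd := danger_None dd; have gy := danger_None dy.
  have low x z : x \in danger g -> z \in danger g -> x != z ->
      conn f u x -> conn f u z -> seen g z = set0 ->
      exists x c, [/\ g x = None, c \notin seen g x & Inv (upd g x c)].
    move=> dx dz xz cx cz sz.
    have [c cP] := exists_unseen (sg _ (D _ dx)).
    apply: (color x z c) => //.
    by apply: leq_trans (card_seen_upd _ _ _ _) _; rewrite sz cards0.
  have [adu|nadu] := boolP (adj d u).
    apply: (low d y) => //; rewrite seen_upd_nadj //; apply/negP => ayu.
    exact: (no_triangle a ayu).
  have sgd : seen g d = seen f d by apply: seen_upd_nadj.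
  have [E|/set0Pn[c1 c1P]] := eqVneq (seen g y) set0; first exact: (low d y).
  have sgy : seen g y \subset [set c0].
    by rewrite -[[set c0]]setU0 -fy; apply: seen_upd.
  have sgyE : seen g y = [set c0].
    apply/eqP; rewrite eqEsubset sgy sub1set.
    by move: (subsetP sgy _ c1P); rewrite inE => /eqP {1}<-.
  have ayu : adj y u.
    by apply: contraT => nayu; move: sgyE; rewrite seen_upd_nadj // fy => /setP/(_ c0); rewrite !inE eqxx.
  have [E|/set0Pn[b bP]] := eqVneq (seen g d) set0.
    by apply: (low y d) => //; rewrite eq_sym.
  have sgdE : seen g d = [set b].
    by apply/eqP; rewrite eq_sym eqEcard sub1set bP cards1 sgd.
  (* When [b] differs from [c0], giving [d] the color [c0] shows [y] nothing new. *)
  have [Eb|nb] := eqVneq b c0; last first.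
    apply: (color d y c0) => //; first by rewrite sgdE inE eq_sym.
    apply: leq_trans (subset_leq_card (seen_upd _ _ _ _)) _.
    by rewrite sgyE setUid cards1.
  rewrite {b bP}Eb in sgdE.
  (* both endpoints see exactly [c0]; the endpoint [z] of potential 3 is made safe
     by giving its last other uncolored neighbor the color [c0] *)
  have last z z' : z \in danger g -> z' \in danger g -> z != z' ->
      conn f u z -> conn f u z' -> adj z z' -> pot f z <= 3 ->
      seen g z = [set c0] -> seen g z' = [set c0] ->
      (forall t, t \in free g z -> t != z' -> c0 \notin seen g t) ->
      exists x c, [/\ g x = None, c \notin seen g x & Inv (upd g x c)].
    move=> dz dz' zz' cz cz' azz' pz sz sz' safe.
    have gz := danger_None dz; have gz' := danger_None dz'.
    have z'free : z' \in free g z by rewrite inE azz' gz'.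
    (* Potential at most 3 and one seen color give at most two free neighbors; danger with [k >= 3]
       gives at least two. They are [z'] and the vertex [t] chosen next. *)
    have f2 : #|free g z| = 2.
      have p1 := leq_trans (pot_extends z ex) pz.
      move: dz; rewrite inE => /andP[_ p2].
      by move: p1 p2; rewrite /pot sz cards1; move: k_gt2; clear; lia.
    have : 0 < #|free g z :\ z'|.
      by move: f2; rewrite (cardsD1 z') z'free add1n => -[->].
    case/card_gt0P => t; rewrite 2!inE => /andP[tz' tfree].
    have := tfree; rewrite inE => /andP[azt /eqP gt].
    have ex2 : extends g (upd g t c0) by apply: extends_upd.
    have zsafe : z \notin danger (upd g t c0).
      rewrite inE negb_and -ltnNge; apply/orP; right.
      have s1 : #|seen (upd g t c0) z| <= 1.
        apply: leq_trans (subset_leq_card (seen_upd _ _ _ _)) _.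
        by rewrite sz setUid cards1.
      have s2 : #|free (upd g t c0) z| < 2.
        rewrite -f2; apply: proper_card; apply/properP; split.
          apply/subsetP => w; rewrite !inE => /andP[-> /eqP h].
          by rewrite (extends_None ex2 h).
        by exists t => //; rewrite !inE /upd eqxx andbF.
      by move: s1 s2 k_gt2; rewrite /pot; clear; lia.
    have only w : w \in danger (upd g t c0) -> conn f u w -> w = z'.
      move=> dw cw; have dw' := danger_extends ex2 dw.
      case: (inv_two I (D _ dz) (D _ dz') (D _ dw')).
      - by apply: conn_trans cz'; rewrite conn_sym.
      - by apply: conn_trans cw; rewrite conn_sym.
      - by move/eqP: zz'.
      - by move=> E; rewrite E dw in zsafe.
      - by [].
    apply: (finish t c0) => //.
    - apply: conn_trans cz _; apply: conn1 => //; exact: extends_None ex _.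
    - exact: safe.
    - by move=> w w' dw dw' cw cw'; rewrite (only w) // (only w').
    - move=> w dw cw; rewrite (only w) // seen_upd_nadj ?sz' ?cards1 ?subn_gt0 //.
      by apply/negP => a'; apply: (no_triangle azz' a').
  have c0fd : c0 \in seen f d by rewrite -sgd sgdE inE.
  have notin z z' t : z \in danger f -> z' \in danger f -> adj z z' ->
      c0 \in seen f z :|: seen f z' -> ~~ adj t u -> t \in free g z -> t != z' ->
      c0 \notin seen g t.
    move=> dz dz' azz' cc ntu; rewrite inE => /andP[azt /eqP gt] tz'.
    rewrite seen_upd_nadj //; apply: (inv_leaf I dz dz' azz') => //.
    by rewrite inE azt (extends_None ex gt).
  case: (inv_pot I (D _ dd) (D _ dy) a) => p.
  - apply: (last d y) => // t tfree ty.
    apply: (notin d y) => //; try exact: D; first by rewrite inE c0fd.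
    (* Bob's move cannot have spoiled [t]: were it adjacent to [u], then [d], [t], [u], [y] would
       form a square. *)
    apply/negP => atu; move: tfree; rewrite inE => /andP[adt _].
    apply: (no_square adt atu (z := u) (t := y)) => //; rewrite 1?adj_sym //.
    exact: guD.
  - apply: (last y d) => //; rewrite 1?eq_sym 1?adj_sym // => t tfree td.
    apply: (notin y d) => //; try exact: D; first by rewrite adj_sym.
      by rewrite inE c0fd orbT.
    apply/negP => atu; move: tfree; rewrite inE => /andP[ayt _].
    exact: (no_triangle ayt atu ayu).
have [E|E] : #|seen f y| = 0 \/ #|seen f d| = 0 by lia.
- by apply: (adjacent d y) => //; lia.
- by apply: (adjacent y d) => //; rewrite 1?eq_sym 1?adj_sym //; lia.
Qed.

Let G := Graph n adj.

Lemma unseen_legal f v c : c \notin seen f v -> legal k (Pos G f) v c.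
Proof.
move=> cP; split; first exact: ltn_ord.
move=> u un vu fu; case/negP: cP; apply/seenP; exists (Ordinal un) => //=.
Qed.

Lemma not_stuck f :
  (forall d, d \in danger f -> #|seen f d| < k) -> ~ stuck k (Pos G f).
Proof.
move=> few [v [vn fv nl]].
have [c cP] : exists c, c \notin seen f (Ordinal vn).
  apply: exists_unseen; have [/few //|nd] := boolP (Ordinal vn \in danger f).
  exact: card_seen_safe.
exact: nl c (unseen_legal cP).
Qed.

Lemma Inv_not_stuck f : Inv f -> ~ stuck k (Pos G f).
Proof.
move=> I; apply: not_stuck => d /(inv_seen I) h; apply: leq_ltn_trans h _.
by rewrite ltn_subLR ?(ltnW k_gt2) // ltnS leq_addl.
Qed.

Lemma all_colored_dec f :
  all_colored (Pos G f) \/ exists v, f v = None.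
Proof.
have [/existsP[v /eqP fv]|no] := boolP [exists v : 'I_n, f v == None]; first by right; exists v.
left=> v vn /= fv; case/existsP: no; exists (Ordinal vn); exact/eqP.
Qed.

(** Induction on the number of uncolored vertices. Between Bob's move and Alice's answer a dangerous
    vertex sees at most k - 1 colors, so nothing is stuck then either. *)
Lemma Inv_wins f : Inv f -> alice_wins k (Pos G f) false.
Proof.
have [m] := ubnP #|[set x : 'I_n | f x == None]|; elim: m f => // m IH f fm I.
apply: aw_bob; first exact: Inv_not_stuck.
move=> _ [v [c [vn fv [ck _] ->]]].
have [done|ng] := all_colored_dec (upd f v c); first exact: aw_done.
have fu : f (Ordinal vn) = None by [].
have [x [c' [gx cP I']]] := reply (c0 := Ordinal ck) I fu ng.
apply: (aw_alice (P' := Pos G (upd (upd f v c) x c'))).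
- apply: not_stuck => d dd; apply: leq_ltn_trans (card_seen_upd f (Ordinal vn) (Ordinal ck) d) _.
  have dd' : d \in danger f.
    exact: (danger_extends (f' := upd f (Ordinal vn) (Ordinal ck)) (extends_upd _ fu) dd).
  by have := inv_seen I dd'; move: k_gt2; clear; lia.
- by exists x, c'; split => //=; apply: unseen_legal.
- apply: IH I'; move: fm; rewrite ltnS; apply: leq_trans.
  apply: proper_card; apply/properP; split.
    apply/subsetP => w; rewrite !inE /upd.
    by case: (val w == val x) => //; case: (val w == v).
  exists (Ordinal vn); rewrite inE; first exact/eqP.
  by rewrite /upd /= eqxx; case: (v == x).
Qed.

End Strategy.

(** * Small forests *)

Section Forest.
Variable G : graph.
Hypothesis forestG : is_forest G.
Let n := gn G.
Implicit Types (x y z t u v w : 'I_n) (A S T : {set 'I_n}).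

Lemma forest_sym x y : gadj G x y = gadj G y x.
Proof. by case: forestG => h _; apply: h. Qed.

Lemma forest_irr x : gadj G x x = false.
Proof. by case: forestG => _ [h _]; apply: h. Qed.

Definition adj_in A : rel 'I_n := fun x y => [&& gadj G x y, x \in A & y \in A].
Definition linked A := connect (adj_in A).

Lemma linked_sym A x y : linked A x y = linked A y x.
Proof.
apply: (sym_connect_sym (e := adj_in A)) => {}x {}y.
by rewrite /adj_in forest_sym [(x \in A) && _]andbC.
Qed.

Lemma linked1 A x y : gadj G x y -> x \in A -> y \in A -> linked A x y.
Proof. by move=> a b c; apply: connect1; rewrite /adj_in a b c. Qed.

Lemma linked_trans A x y z : linked A x y -> linked A y z -> linked A x z.
Proof. exact: connect_trans. Qed.

Lemma linkedS A T x y : A \subset T -> linked A x y -> linked T x y.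
Proof.
move=> /subsetP AT; apply: connect_sub => {}x {}y /and3P[a /AT b /AT c].
exact: linked1.
Qed.

Lemma linked_ind A T x y :
  (forall u w, adj_in A u w -> u \in T -> w \in T) -> linked A x y -> x \in T -> y \in T.
Proof.
move=> cl /connectP[p pp ->] {y}; elim: p x pp => //= w p IH x /andP[a pp] xT.
exact: IH pp (cl _ _ a xT).
Qed.

Lemma linked_in A x y : linked A x y -> x != y -> (x \in A) && (y \in A).
Proof.
move=> l xy; have xA : x \in A.
  case/connectP: l => -[_ E|w p /= /andP[/and3P[_ -> _] //]].
  by rewrite E eqxx in xy.
rewrite xA /=; apply: (linked_ind (T := A)) l xA => u w /and3P[] //.
Qed.

(** A simple path from [x] to [y] inside [A] would close up through [v] to a cycle. This is how
    acyclicity enters all later arguments. *)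
Lemma neighbors_unlinked A v x y :
  gadj G v x -> gadj G v y -> x != y -> v \notin A -> ~ linked A x y.
Proof.
move=> vx vy xy vA /connectP[p0 pp0 E]; move: E xy vy.
case/shortenP: pp0 => p pp up _ -> xy vy.
case: forestG => _ [_]; apply; exists (map val (v :: x :: p)); split.
- by case: p xy {pp up vy} => //=; rewrite eqxx.
- rewrite (map_inj_uniq val_inj) cons_uniq up andbT.
  apply: contra vA; rewrite inE => /orP[/eqP E|].
    by rewrite E forest_irr in vx.
  move: pp; elim: p x {up xy vy vx} => //= w p IH x /andP[/and3P[_ _ wA] pp].
  by rewrite inE => /orP[/eqP->//|]; apply: IH pp.
- by apply/allP => _ /mapP[w _ ->]; apply: ltn_ord.
- rewrite -[map val _]/(map val _) cycle_map /= vx /= rcons_path /=.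
  rewrite [X in _ && X]forest_sym vy andbT.
  by apply: sub_path pp => u w /and3P[].
Qed.

Lemma linked_avoid A v x y : linked A x y -> ~~ linked A x v -> linked (A :\ v) x y.
Proof.
move=> l nv; suff: y \in [set w | linked (A :\ v) x w] by rewrite inE.
apply: linked_ind l _; last by rewrite inE; apply: connect0.
have sub : A :\ v \subset A by apply: subsetDl.
move=> u w /and3P[a b c]; rewrite !inE => l.
apply: linked_trans (l) _; apply: linked1 => //; rewrite !inE ?b ?c andbT.
  by apply: contraNneq nv => <-; apply: linkedS sub _.
apply: contraNneq nv => <-; apply: linked_trans (linkedS sub l) _; exact: linked1.
Qed.

Lemma linked_last A v x : linked A x v -> x != v ->
  exists2 w : 'I_n, gadj G w v & linked (A :\ v) x w.
Proof.
move=> l xv; have [/existsP[w /andP[a b]]|no] := boolP [exists w : 'I_n, gadj G w v && linked (A :\ v) x w].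
  by exists w.
suff: v \in [set w | linked (A :\ v) x w].
  by rewrite inE => /linked_in/(_ xv); rewrite !inE eqxx andbF.
apply: linked_ind l _; last by rewrite inE; apply: connect0.
move=> u w /and3P[a b c]; rewrite !inE => l.
have wv : w != v by apply: contraNneq no => E; apply/existsP; exists u; rewrite -{1}E a.
have uv : u != v.
  apply: contraTneq l => ->; apply/negP => /linked_in/(_ xv).
  by rewrite !inE eqxx andbF.
by apply: linked_trans l _; apply: linked1; rewrite // !inE ?wv ?uv ?b ?c.
Qed.

(** * Degrees and edge counts in a forest *)

Definition deg_in S x := #|[set y in S | gadj G x y]|.

(** If every vertex had two neighbors in [S], one could walk on forever without turning back, which
    a descent excludes. *)
Lemma exists_leaf S : S != set0 -> exists2 x, x \in S & deg_in S x <= 1.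
Proof.
case/set0Pn => x0 x0S.
have [/existsP[x /andP[a b]]|no] := boolP [exists x, (x \in S) && (deg_in S x <= 1)].
  by exists x.
have next u v : u \in S -> exists w, [/\ w \in S, gadj G u w & w != v].
  move=> uS; have : 1 < deg_in S u.
    by rewrite ltnNge; apply: contra no => h; apply/existsP; exists u; rewrite uS.
  rewrite /deg_in (cardsD1 v [set y in S | gadj G u y]) => h.
  have : 0 < #|[set y in S | gadj G u y] :\ v|.
    by rewrite lt0n; apply: contraTneq h => ->; case: (v \in _).
  by case/card_gt0P => w; rewrite !inE => /andP[a /andP[b c]]; exists w.
(* The measure is the set reachable from [u] without passing [v]. Stepping from the edge ([v], [u])
   on to ([u], [w]) removes [u] from it and adds nothing, since a path from [w] back to [v] would
   close a cycle. *)
suff no_edge : forall m v u, v \in S -> u \in S -> gadj G v u ->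
    #|[set x | linked (S :\ v) u x]| < m -> False.
  have [w [wS a _]] := next x0 x0 x0S.
  by have := no_edge _ _ _ x0S wS a (ltnSn _).
elim=> // m IH v u vS uS vu; rewrite ltnS => lem.
have [w [wS uw wv]] := next u v uS.
have uv : u != v by apply: contraTneq vu => ->; rewrite forest_irr.
have wu : w != u by apply: contraTneq uw => ->; rewrite forest_irr.
apply: (IH u w) => //; apply: leq_trans lem; apply: proper_card; apply/properP; split.
  apply/subsetP => x; rewrite !inE => l.
  have nv : ~~ linked (S :\ u) w v.
    apply/negP; apply: (neighbors_unlinked uw) => //; first by rewrite forest_sym.
    by rewrite !inE eqxx.
  apply: (linked_trans (y := w)); first by apply: linked1; rewrite // !inE ?uv ?wv.
  by apply: linkedS (linked_avoid l nv); rewrite setSD // subsetDl.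
exists u; first by rewrite inE; apply: connect0.
by rewrite inE; apply/negP => /linked_in/(_ wu); rewrite !inE eqxx andbF.
Qed.

(** Counts ordered pairs, so [edges S S] is twice the number of edges inside [S]. *)
Definition edges S T := \sum_(x in S) \sum_(y in T) (gadj G x y : nat).

Lemma deg_inE S x : deg_in S x = \sum_(y in S) (gadj G x y : nat).
Proof.
rewrite /deg_in -sum1_card big_mkcond [RHS]big_mkcond; apply: eq_bigr => y _.
by rewrite inE; case: (y \in S) => //=; case: (gadj G x y).
Qed.

Lemma edgesC S T : edges S T = edges T S.
Proof.
rewrite /edges exchange_big; apply: eq_bigr => x _; apply: eq_bigr => y _.
by rewrite forest_sym.
Qed.

Lemma edges_split S T A : edges S T = edges S (T :&: A) + edges S (T :\: A).
Proof. by rewrite /edges -big_split; apply: eq_bigr => x _; rewrite (big_setID A). Qed.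

Lemma edges1 x T : edges [set x] T = deg_in T x.
Proof. by rewrite /edges big_set1 deg_inE. Qed.

(** The bound of s - 1 edges on s vertices, doubled; a leaf is removed at each step of the
    induction. *)
Lemma forest_edges S : S != set0 -> edges S S + 2 <= 2 * #|S|.
Proof.
have [m] := ubnP #|S|; elim: m S => // m IH S; rewrite ltnS => Sm S0.
have [x xS d1] := exists_leaf S0.
have E1 : edges [set x] [set x] = 0 by rewrite /edges !big_set1 forest_irr.
have I1 : S :&: [set x] = [set x] by apply/setIidPr; rewrite sub1set.
have Ex : edges [set x] S = edges [set x] (S :\ x).
  by rewrite (edges_split _ S [set x]) I1 E1.
have ES : edges S S = edges (S :\ x) (S :\ x) + 2 * edges [set x] S.
  rewrite (edges_split S S [set x]) I1 (edgesC S [set x]) (edgesC S (S :\ x)).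
  rewrite (edges_split (S :\ x) S [set x]) I1 (edgesC (S :\ x) [set x]) -Ex.
  clear; lia.
have cS : #|S| = #|S :\ x|.+1 by rewrite (cardsD1 x) xS.
rewrite edges1 in ES.
have [S'0|S'0] := eqVneq (S :\ x) set0.
  have d0 : deg_in S x = 0.
    by rewrite -edges1 Ex S'0 edges1 deg_inE big_set0.
  rewrite ES d0 S'0 cS S'0 cards0.
  by rewrite /edges big_set0.
have : #|S :\ x| < m by rewrite -cS.
move/IH => /(_ S'0); move: d1; rewrite ES cS; clear; lia.
Qed.

(** With three colors, a vertex must be in [big] to be dangerous and in [huge] to have potential
    above 3. *)
Definition big : {set 'I_n} := [set x | 2 < deg_in setT x].
Definition huge : {set 'I_n} := [set x | 3 < deg_in setT x].

(** With b = [#|big|] and h = [#|huge|], the degrees in [big] sum to at least 3b + h, and at most 2b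
    - 2 of this comes from edges inside [big]. The remaining edges are counted again at their other
    ends, so 2(3b + h) - (2b - 2) <= 2n - 2. *)
Lemma forest_big : 0 < n -> 2 * #|big| + #|huge| <= n.-2.
Proof.
move=> n0.
have [B0|B0] := eqVneq big set0.
  suff -> : huge = set0 by rewrite B0 cards0.
  apply/eqP; rewrite -subset0 -B0; apply/subsetP => x; rewrite !inE; exact: ltnW.
have T0 : [set: 'I_n] != set0 by rewrite -card_gt0 cardsT card_ord.
have := forest_edges T0; have := forest_edges B0; rewrite cardsT card_ord.
have ET : edges setT setT = edges big setT + edges (~: big) setT.
  rewrite (edges_split setT setT big) setTI setTD.
  by rewrite (edgesC setT big) (edgesC setT (~: big)).
have EB : edges big setT = edges big big + edges big (~: big).
  by rewrite (edges_split big setT big) setTI setTD.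
have EC : edges big (~: big) <= edges (~: big) setT.
  by rewrite (edgesC big (~: big)) (edges_split (~: big) setT big) setTI leq_addr.
have : 3 * #|big| + #|huge| <= edges big setT.
  have hb : huge \subset big by apply/subsetP => x; rewrite !inE; apply: ltnW.
  have -> : #|huge| = \sum_(x in big) (x \in huge : nat).
    rewrite -sum1_card -(setIidPr hb) [RHS]big_mkcond [LHS]big_mkcond.
    by apply: eq_bigr => x _; rewrite in_setI; case: (x \in big); case: (x \in huge).
  rewrite mulnC -sum_nat_const -big_split; apply: leq_sum => x.
  rewrite -deg_inE !inE; move: (deg_in setT x) => d; clear=> /=; lia.
move: ET EB EC; clear; lia.
Qed.

(** * A separating vertex and Alice's opening *)

Definition comp v x : {set 'I_n} := [set y | linked [set~ v] x y].
(* Two disjoint sets cannot both be bad, which drives the descent of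
   [exists_centroid]. *)
Definition bad A := (2 < #|A :&: big|) || (1 < #|A :&: huge|).

(** Otherwise every vertex has a bad branch. Moving from [v] into its bad branch [K], to the vertex
    [v'] where [K] is attached, yields a bad branch of [v'] that meets [K] and so lies strictly
    inside it; this cannot go on forever. *)
Lemma exists_centroid : 0 < n -> n < 14 ->
  exists v, forall x, x != v -> ~~ bad (comp v x).
Proof.
move=> n0 n14.
have [/existsP[v /forallP vP]|no] :=
    boolP [exists v, forall x, (x != v) ==> ~~ bad (comp v x)].
  by exists v => x xv; move: (vP x); rewrite xv.
have H v : exists2 x, x != v & bad (comp v x).
  have /forallPn[x] : ~~ [forall x, (x != v) ==> ~~ bad (comp v x)].
    by apply: contra no => h; apply/existsP; exists v.
  by rewrite negb_imply negbK => /andP[]; exists x.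
(* Two disjoint bad sets contain together 6 big vertices, or 5 big ones of which 2 are huge, or 4
   huge ones. Each case makes [2 * #|big| + #|huge|] at least 12, above the bound 11. *)
have meet A S : bad A -> bad S -> exists2 x, x \in A & x \in S.
  have := forest_big n0 => cnt bA bS.
  have [A0|/set0Pn[x]] := eqVneq (A :&: S) set0; last first.
    by rewrite inE => /andP[]; exists x.
  have disj T : #|A :&: T| + #|S :&: T| <= #|T|.
    rewrite -cardsUI -setIIl A0 set0I cards0 addn0 -setIUl.
    by apply: subset_leq_card; apply: subsetIr.
  have hb T : #|T :&: huge| <= #|T :&: big|.
    by apply: subset_leq_card; apply: setIS; apply/subsetP => x; rewrite !inE; apply: ltnW.
  have := disj big; have := disj huge; have := hb A; have := hb S.
  move: bA bS; rewrite /bad; move: cnt n14; clear; lia.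
suff descent : forall m v x, x != v -> bad (comp v x) -> #|comp v x| < m -> False.
  have [x xv bx] := H (Ordinal n0).
  by have := descent _ _ _ xv bx (ltnSn _).
elim=> // m IH v x xv bK; rewrite ltnS => cm.
pose K := comp v x; rewrite -/K in bK cm.
(* [v'] is the unique neighbor of [v] in [K], or just [x] when [K] is a whole tree not attached to
   [v]. *)
have [v' v'K choice] : exists2 v', v' \in K &
    forall w, w \in K -> gadj G w v -> w = v'.
  have [/existsP[w /andP[wK wv]]|none] := boolP [exists w, (w \in K) && gadj G w v].
    exists w => // w' w'K w'v; apply/eqP; apply: contraT => ww'.
    have := @neighbors_unlinked [set~ v] v w' w; rewrite forest_sym w'v forest_sym wv.
    case=> //; first by rewrite !inE eqxx.
    by move: wK w'K; rewrite !inE => l; rewrite linked_sym => l'; apply: linked_trans l' l.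
  exists x; first by rewrite inE; apply: connect0.
  by move=> w wK wv; case/existsP: none; exists w; rewrite wK.
have [x' x'v' bK'] := H v'.
apply: (IH v' x') => //; apply: leq_trans cm.
have [z zK zK'] := meet _ _ bK bK'.
have zv' : z != v'.
  apply: contraTneq zK' => ->; rewrite inE; apply/negP => /linked_in/(_ x'v').
  by rewrite !inE eqxx andbF.
have zv : z != v.
  apply: contraTneq zK => ->; rewrite inE; apply/negP => /linked_in/(_ xv).
  by rewrite !inE eqxx andbF.
have subv : [set~ v'] :\ v \subset [set~ v].
  by apply/subsetP => w; rewrite !inE => /andP[].
rewrite !inE in zK zK'.
(* A path from [z] in [K] to [v] has to enter [v] from [v']. *)
have nzv : ~~ linked [set~ v'] z v.
  apply/negP => /linked_last/(_ zv)[w wv l].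
  have E : w = v'.
    by apply: choice => //; rewrite inE; apply: linked_trans zK (linkedS subv l).
  by move: l; rewrite E => /linked_in/(_ zv'); rewrite !inE eqxx !andbF.
apply: proper_card; apply/properP; split; last first.
  exists v' => //; rewrite inE; apply/negP => /linked_in/(_ x'v').
  by rewrite !inE eqxx andbF.
apply/subsetP => y; rewrite !inE => l.
apply: linked_trans zK (linkedS subv (linked_avoid _ nzv)).
by apply: linked_trans l; rewrite linked_sym.
Qed.

(** Alice colors the separating vertex [v]. Each branch then has at most two big vertices, at most
    one huge one and at most one neighbor of [v]; only such a neighbor sees a color. *)
Lemma small_forest_alice_wins : n < 14 -> alice_wins_game 3 G.
Proof.
move=> n14; rewrite /alice_wins_game /uncolored.
have [n0|n0] := posnP n; first by apply: aw_done => v; rewrite -/n n0.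
have irr x y : gadj G x y -> x != y by apply: contraTneq => ->; rewrite forest_irr.
have [v vP] := exists_centroid n0 n14.
have tri x y z : gadj G x y -> gadj G y z -> gadj G x z -> False.
  move=> xy yz xz; apply: (neighbors_unlinked (A := [set~ x]) xy xz (irr _ _ yz)).
    by rewrite !inE eqxx.
  by apply: linked1; rewrite // !inE eq_sym irr.
have sq x y z t : gadj G x y -> gadj G y z -> gadj G z t -> gadj G t x ->
    x != z -> y != t -> False.
  move=> xy yz zt tx xz yt.
  have xt : gadj G x t by rewrite forest_sym.
  apply: (neighbors_unlinked (A := [set~ x]) xy xt yt).
    by rewrite !inE eqxx.
  have yx : y != x by rewrite eq_sym irr.
  have zx : z != x by rewrite eq_sym.
  by apply: (linked_trans (y := z)); apply: linked1; rewrite // !inE // irr.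
pose f0 : nat -> option nat := fun _ => None; pose c0 : 'I_3 := ord0.
have ex : extends n f0 (upd f0 v c0) by apply: (extends_upd (k := 3)).
have fN x : upd f0 v c0 x = None -> x != v.
  by apply: contra_eq_neq => ->; rewrite /upd eqxx.
have cl x y : conn (gadj G) (upd f0 v c0) x y -> linked [set~ v] x y.
  apply: connect_sub => {}x {}y /and3P[a /eqP/fN b /eqP/fN c].
  by apply: linked1; rewrite // !inE.
have seenv x (c : 'I_3) : c \in seen 3 (gadj G) (upd f0 v c0) x -> gadj G x v.
  by case/seenP => u; rewrite /upd; case: eqP => // /val_inj ->.
have seen1 x : #|seen 3 (gadj G) (upd f0 v c0) x| <= gadj G x v.
  have sub := seen_upd (gadj G) f0 v c0 x.
  case a: (gadj G x v); last first.
    by rewrite leqn0 cards_eq0; apply/set0Pn => -[c /seenv]; rewrite a.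
  apply: leq_trans (card_seen_upd _ _ _ _ _) _; rewrite ltnS leqn0 cards_eq0.
  by apply/set0Pn => -[c /seenP[]].
have potd x : pot 3 (gadj G) (upd f0 v c0) x <= deg_in setT x.
  apply: leq_trans (pot_extends _ _ _ ex) _ => //.
  rewrite /pot (_ : seen _ _ _ _ = set0) ?cards0; last first.
    by apply/eqP/set0Pn => -[c /seenP[]].
  by apply: subset_leq_card; apply/subsetP => y; rewrite !inE => /andP[].
have dP x : x \in danger n 3 (gadj G) (upd f0 v c0) -> x != v /\ x \in big.
  by rewrite inE => /andP[/eqP/fN -> p]; rewrite inE (leq_trans p).
have noboth x y : x != y -> linked [set~ v] x y -> ~ (gadj G x v /\ gadj G y v).
  move=> xy l [xv yv]; apply: (neighbors_unlinked (v := v) _ _ xy _ l).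
  - by rewrite forest_sym.
  - by rewrite forest_sym.
  - by rewrite !inE eqxx.
apply: (aw_alice (P' := Pos G (upd f0 v c0))).
- case=> u [un _ nl]; apply: (nl 0); split=> // w _ _ //.
- by exists v, 0; split=> //; split.
suff I : Inv n 3 (gadj G) (upd f0 v c0).
  have G_eta : Graph n (gadj G) = G by rewrite /n; case: (G).
  have := Inv_wins (n := n) (k := 3) (adj := gadj G) isT forest_sym tri sq I.
  by rewrite G_eta.
have comp3 x y z : x \in danger n 3 (gadj G) (upd f0 v c0) ->
    y \in danger n 3 (gadj G) (upd f0 v c0) -> z \in danger n 3 (gadj G) (upd f0 v c0) ->
    linked [set~ v] x y -> linked [set~ v] x z -> [\/ x = y, x = z | y = z].
  move=> /dP[xv xb] /dP[_ yb] /dP[_ zb] xy xz.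
  have [->|nxy] := eqVneq x y; first by constructor 1.
  have [->|nxz] := eqVneq x z; first by constructor 2.
  have [->|nyz] := eqVneq y z; first by constructor 3.
  case/negP: (vP x xv); apply/orP; left.
  have sub : [set x; y; z] \subset comp v x :&: big.
    apply/subsetP => w; rewrite !in_setU !in_set1 -orbA => /or3P[] /eqP ->;
      rewrite in_setI ?xb ?yb ?zb andbT inE //; exact: connect0.
  apply: leq_trans (subset_leq_card sub).
  by rewrite -setUA !cardsU1 cards1 !inE negb_or nxy nxz nyz.
have adjP x y : x \in danger n 3 (gadj G) (upd f0 v c0) ->
    y \in danger n 3 (gadj G) (upd f0 v c0) -> gadj G x y -> linked [set~ v] x y.
  by move=> /dP[xv _] /dP[yv _] a; apply: linked1; rewrite // !inE.
split.
- by move=> x _; apply: leq_trans (seen1 x) _; case: (gadj G x v).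
- by move=> x y z dx dy dz /cl xy /cl xz; apply: comp3.
- move=> x y dx dy xy /cl l; apply: leq_trans (leq_add (seen1 x) (seen1 y)) _.
  by have := noboth x y xy l; case: (gadj G x v); case: (gadj G y v) => //= -[].
- move=> x y dx dy a; have l := adjP _ _ dx dy a.
  have xy := irr _ _ a; have [xv _] := dP x dx.
  have [hx|hx] := leqP (deg_in setT x) 3; first by left; apply: leq_trans hx.
  right; apply: leq_trans (potd y) _; rewrite leqNgt; apply/negP => hy.
  case/negP: (vP x xv); apply/orP; right.
  have sub : [set x; y] \subset comp v x :&: huge.
    apply/subsetP => w; rewrite !in_setU !in_set1 => /orP[] /eqP ->; rewrite !inE ?hx ?hy andbT //.
    exact: connect0.
  by apply: leq_trans (subset_leq_card sub); rewrite cards2 xy.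
(* The only color on the board is that of [v]. If [t] saw it together with [x] or [y], one branch
   would contain two neighbors of [v]. *)
- move=> x y t c dx dy a; rewrite inE => /andP[xt /eqP/fN tv] ty cc.
  have [xv _] := dP x dx.
  have lxt : linked [set~ v] x t by apply: linked1; rewrite // !inE.
  apply/negP => /seenv tv'; move: cc; rewrite inE => /orP[] /seenv h.
    by apply: (noboth x t (irr _ _ xt) lxt).
  apply: (noboth y t _ _ (conj h tv')); first by rewrite eq_sym.
  by apply: linked_trans lxt; rewrite linked_sym; apply: adjP.
Qed.

End Forest.

(** * Bob on Tprime *)

(* [has] and [all] in terms of [if], so that [vm_compute], which is
   call-by-value, stops at the first witness. *)
Fixpoint find_true (T : Type) (p : T -> bool) (l : seq T) : bool :=
  if l is x :: l' then (if p x then true else find_true p l') else false.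
Fixpoint find_false (T : Type) (p : T -> bool) (l : seq T) : bool :=
  if l is x :: l' then (if p x then find_false p l' else false) else true.

Lemma find_trueE T (p : T -> bool) l : find_true p l = has p l.
Proof. by elim: l => //= x l ->; case: (p x). Qed.
Lemma find_falseE T (p : T -> bool) l : find_false p l = all p l.
Proof. by elim: l => //= x l ->; case: (p x). Qed.

(* A spine vertex: its color, the colors it sees outside the spine, and a lower
   bound on the number of its uncolored leaves to which Alice has added nothing. *)
Definition vstate := (option nat * seq nat * nat)%type.
Definition vs0 : vstate := (None, [::], 0).

Section Abstract.
Variable k : nat.
Implicit Type s : seq vstate.

Definition hue s i := (nth vs0 s i).1.1.
Definition outer s i := (nth vs0 s i).1.2.
Definition spare s i := (nth vs0 s i).2.
Definition consec i j := (i == j.+1) || (j == i.+1).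
Definition view s i :=
  outer s i ++ pmap (fun j => if consec i j then hue s j else None) (iota 0 4).
Definition put s i v := set_nth vs0 s i v.

Definition stuckb s :=
  has (fun i => (hue s i == None) && all (mem (view s i)) (iota 0 k)) (iota 0 4).

(* [(true, i, c)] colors a leaf of [i], [(false, i, c)] colors [i] itself. *)
Definition move := (bool * nat * nat)%type.

Definition playable s (m : move) :=
  let: (b, i, c) := m in
  [&& i < 4, c < k, hue s i == None &
      if b then (0 < spare s i) && (c \notin outer s i) else c \notin view s i].

(** A colored spine vertex can no longer be stuck, so its outer colors and spare leaves are
    erased. *)
Definition play s (m : move) :=
  let: (b, i, c) := m in
  put s i (if b then (None, c :: outer s i, (spare s i).-1) else (Some c, [::], 0)).

(** A new outer color at [i] arises by coloring a leaf, which uses up a spare one, or by hanging a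
    new colored leaf on [i], which does not. *)
Definition active_options s :=
  flatten [seq if hue s i == None then
      [seq put s i (Some c, [::], 0) | c <- iota 0 k & c \notin view s i] ++
      flatten [seq [:: put s i (None, c :: outer s i, (spare s i).-1);
                       put s i (None, c :: outer s i, spare s i)]
              | c <- iota 0 k & c \notin outer s i]
    else [::] | i <- iota 0 4].

(* Alice spoils a leaf of [i] without letting [i] see a new color. *)
Definition block s i := put s i (None, outer s i, (spare s i).-1).

(** [s] itself stands for a pass and for moves without trace on the uncolored spine vertices, such
    as coloring a leaf of a colored one. *)
Definition alice_options s :=
  active_options s ++ s :: [seq block s i | i <- iota 0 4 & hue s i == None].

(* Candidates for a move that deprives a spine vertex of its last legal color. *)
Definition final_moves s : seq move :=
  flatten [seq if hue s i == None then
      if [seq c <- iota 0 k | c \notin view s i] is [:: c] then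
        (true, i, c) :: [seq (false, j, c) | j <- iota 0 4 & consec i j]
      else [::]
    else [::] | i <- iota 0 4].

Definition all_moves : seq move :=
  flatten [seq flatten [seq [:: (true, i, c); (false, i, c)] | c <- iota 0 k] | i <- iota 0 4].

Definition open s := has (fun i => hue s i == None) (iota 0 4).

(** Iterative deepening with Bob to move: at depth 0 he must win at once, and each further level
    allows him one more move and Alice one more answer. *)
Fixpoint bob_search (d : nat) s : bool :=
  if d is d'.+1 then
    if bob_search d' s then true else
    find_true (fun m =>
      if playable s m then
        let t := play s m in
        if open t then find_false (bob_search d') (alice_options t) else false
      else false) all_moves
  else if stuckb s then true else
    find_true (fun m => if playable s m then stuckb (play s m) else false)
      (final_moves s).

Definition bob_ready d s :=
  if open s then find_false (bob_search d) (alice_options s) else false.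

(** * Concrete positions and their abstraction *)

Definition stem w := nth 0 [:: 0; 1; 2; 3; 0; 0; 0; 3; 3; 3; 1; 1; 2; 2] w.
Definition twig w i := [&& 3 < w, w < 14 & stem w == i].

Lemma twig_adj w x : 3 < w < 14 -> x < 14 ->
  (gadj Tprime x w = twig w x) * (gadj Tprime w x = twig w x).
Proof.
have /allP H : all (fun w => all (fun x => (gadj Tprime x w == twig w x) && (gadj Tprime w x == twig w x)) (iota 0 14)) (iota 4 10).
  by vm_compute.
move=> w14 x14; have /H/allP/(_ x) : w \in iota 4 10 by rewrite mem_iota.
by rewrite mem_iota => /(_ x14) /andP[/eqP -> /eqP ->].
Qed.

Lemma spine_adj i j : i < 4 -> j < 4 -> gadj Tprime i j = consec i j.
Proof. by case: i => [|[|[|[|]]]] //; case: j => [|[|[|[|]]]]. Qed.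

(** The vertices from 14 on are those added by Alice. They are colored from the start, so all
    coloring moves take place in [Tprime]. *)
Record framed P : Prop := Framed {
  framed_size : 14 <= gn (pg P);
  framed_adj : forall x y, x < 14 -> y < 14 -> gadj (pg P) x y = gadj Tprime x y;
  framed_new : forall v, 14 <= v -> v < gn (pg P) -> col P v <> None }.

(** The leaves in [ws] have the uncolored vertex [i] as their only neighbor, so Bob may give them
    any color. *)
Definition vmodels P i (a : vstate) : Prop :=
  a.1.1 = col P i /\ (col P i = None ->
    (forall c, c < k -> c \in a.1.2 <->
       exists u, [/\ 3 < u, u < gn (pg P), gadj (pg P) i u & col P u = Some c]) /\
    exists ws : seq nat, [/\ uniq ws, a.2 <= size ws & forall w : nat, w \in ws ->
      [/\ twig w i, col P w = None &
          forall u, u < gn (pg P) -> gadj (pg P) w u -> u = i]]).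

Definition models P s := framed P /\ forall i, i < 4 -> vmodels P i (nth vs0 s i).

Lemma framed_color P v c : framed P -> framed (set_col P v c).
Proof. by case=> a b d; split=> // u ? ?; rewrite /=; case: eqP => // _; apply: d. Qed.

Lemma framed_leaf P v c : framed P -> framed (add_leaf P v c).
Proof.
case=> a b d; split=> /= [|x y x14 y14|u u14 uN].
- exact: ltnW.
- rewrite b // (ltn_eqF (leq_trans x14 a)) (ltn_eqF (leq_trans y14 a)).
  by rewrite (leq_trans x14 a) (leq_trans y14 a) !andbF !orbF.
- case: eqP => // /eqP uN'; apply: d => //; rewrite ltn_neqAle uN' //.
Qed.

Lemma models_put P P' s i a : models P s -> framed P' -> vmodels P' i a ->
  (forall j, j < 4 -> j != i -> vmodels P j (nth vs0 s j) -> vmodels P' j (nth vs0 s j)) ->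
  models P' (put s i a).
Proof.
move=> [_ M] F' Ma Mo; split=> // j j4; rewrite nth_set_nth /=.
by case: eqP => [->//|/eqP ji]; apply: Mo => //; apply: M.
Qed.

Lemma framed_twig P v i : framed P -> 3 < v -> v < 14 -> i < 4 ->
  gadj (pg P) i v = twig v i.
Proof.
move=> F v3 v14 i4; have i14 : i < 14 by apply: leq_trans i4 _.
by rewrite (framed_adj F) // twig_adj // v3.
Qed.

Lemma vmodels_color_far P v c i a : framed P -> v < 14 -> i < 4 -> col P v = None ->
  v != i -> ~~ twig v i -> vmodels P i a -> vmodels (set_col P v c) i a.
Proof.
move=> F v14 i4 vN vi tv [Ma Mb]; split; rewrite /= eq_sym (negPf vi) // => /Mb[Mo [ws [wu wm wP]]].
split=> [d dk|].
  rewrite (Mo d dk); split=> -[u [u3 uN iu cu]]; exists u; split=> //.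
    by case: eqP => // uv; rewrite uv vN in cu.
  move: cu; case: eqP => // uv; rewrite uv in u3 iu.
  by rewrite (framed_twig F) // (negPf tv) in iu.
exists ws; split=> // w wws; have [tw wN wu'] := wP w wws; split=> //.
by case: eqP => // wv; rewrite -wv tw in tv.
Qed.

Lemma vmodels_colored P v c i a : v != i -> col P i <> None ->
  vmodels P i a -> vmodels (set_col P v c) i a.
Proof. by move=> vi iC [Ma Mb]; split; rewrite /= eq_sym (negPf vi). Qed.

(** Coloring [v] costs a spare leaf, unless [v] has a neighbor besides [i]: then it was not counted
    as spare. *)
Lemma vmodels_color_twig P v c i a S m : framed P -> i < 4 -> twig v i ->
  col P v = None -> col P i = None -> vmodels P i a ->
  (forall d, (d \in S) = (d == c) || (d \in a.1.2)) ->
  m <= a.2.-1 \/ m <= a.2 /\ (exists u, [/\ u < gn (pg P), gadj (pg P) v u & u <> i]) ->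
  vmodels (set_col P v c) i (None, S, m).
Proof.
move=> F i4 tv vN iN [_ /(_ iN)[Mo [ws [wu wm wP]]]] SE mE.
have /and3P[v3 v14 _] := tv.
have iv : i == v = false by apply: ltn_eqF; apply: leq_trans i4 _.
split; rewrite /= iv // => _; split=> [d dk|].
  rewrite SE; split.
    case: eqVneq => [-> _|_ /= /(Mo d dk)[u [u3 uN iu cu]]].
      exists v; rewrite eqxx; split=> //; first exact: leq_trans v14 (framed_size F).
      by rewrite (framed_twig F).
    by exists u; split=> //; case: eqP => // uv; rewrite uv vN in cu.
  case=> u [u3 uN iu]; case: eqP => [_ [->]|_ cu]; first by rewrite eqxx.
  by apply/orP; right; apply/(Mo d dk); exists u.
exists (rem v ws); split.
- exact: rem_uniq.
- have [vws|vws] := boolP (v \in ws).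
    rewrite size_rem //; case: mE => [h|[_ [u [uN vu ui]]]].
      by apply: leq_trans h _; rewrite -!subn1 leq_sub2r.
    by have [_ _ /(_ u uN vu)] := wP v vws.
  rewrite rem_id //; case: mE => [h|[h _]]; apply: leq_trans wm => //.
  by apply: leq_trans h _; apply: leq_pred.
- move=> w; rewrite mem_rem_uniq // inE => /andP[/= /negPf wv /wP[tw wN wu']].
  by rewrite wv.
Qed.

Lemma add_leaf_adj P (v c x u : nat) : x != v -> x < gn (pg P) ->
  gadj (pg (add_leaf P v c)) x u = (u < gn (pg P)) && gadj (pg P) x u.
Proof.
by move=> /negPf xv xN; rewrite /add_leaf /= xN xv (ltn_eqF xN) /= !orbF.
Qed.

Lemma add_leaf_col P v c x : x < gn (pg P) -> col (add_leaf P v c) x = col P x.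
Proof. by move=> xN; rewrite /add_leaf /= (ltn_eqF xN). Qed.

Lemma add_leaf_size P v c : gn (pg (add_leaf P v c)) = (gn (pg P)).+1.
Proof. by []. Qed.

Lemma vmodels_leaf_far P v c i a : framed P -> i < 4 ->
  v != i -> ~~ twig v i -> vmodels P i a -> vmodels (add_leaf P v c) i a.
Proof.
move=> F i4 vi tv [Ma Mb]; have N14 := framed_size F.
have iN : i < gn (pg P) by apply: leq_trans i4 (leq_trans _ N14).
split; rewrite add_leaf_col // => /Mb[Mo [ws [wu wm wP]]]; split=> [d dk|].
  rewrite (Mo d dk); split=> -[u [u3 uN iu cu]].
    exists u; rewrite add_leaf_size ltnS (ltnW uN); split=> //.
      by rewrite add_leaf_adj 1?eq_sym // uN.
    by rewrite add_leaf_col.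
  rewrite add_leaf_adj 1?eq_sym // in iu.
  by case/andP: iu => uN' iu; rewrite add_leaf_col // in cu; exists u.
exists ws; split=> // w /wP[tw wN wu']; have /and3P[_ w14 _] := tw.
have wN' : w < gn (pg P) := leq_trans w14 N14.
split=> //; first by rewrite add_leaf_col.
move=> u _; rewrite add_leaf_adj //.
  by case/andP; apply: wu'.
by apply: contraNneq tv => <-.
Qed.

Lemma vmodels_leaf_colored P v c i a : i < gn (pg P) -> col P i <> None ->
  vmodels P i a -> vmodels (add_leaf P v c) i a.
Proof. by move=> iN iC [Ma Mb]; split; rewrite add_leaf_col. Qed.

Lemma vmodels_leaf_self P c i a S : framed P -> i < 4 -> col P i = None ->
  vmodels P i a -> (forall d, (d \in S) = (d == c) || (d \in a.1.2)) ->
  vmodels (add_leaf P i c) i (None, S, a.2).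
Proof.
move=> F i4 iNone [_ /(_ iNone)[Mo [ws [wu wm wP]]]] SE; have N14 := framed_size F.
have iN : i < gn (pg P) by apply: leq_trans i4 (leq_trans _ N14).
split; rewrite add_leaf_col // => _; split=> [d dk|].
  rewrite SE; split.
    case: eqVneq => [-> _|_ /= /(Mo d dk)[u [u3 uN iu cu]]].
      exists (gn (pg P)); rewrite /add_leaf /= !eqxx !orbT; split=> //.
      by apply: leq_trans N14.
    exists u; rewrite /add_leaf /= iN uN iu (ltn_eqF uN); split=> //; exact: ltnW.
  case=> u [u3 uN iu]; have [uN'|uN'] := eqVneq u (gn (pg P)).
    by rewrite uN' /add_leaf /= eqxx => -[->]; rewrite eqxx.
  have {}uN : u < gn (pg P) by rewrite ltn_neqAle uN'.
  rewrite add_leaf_col // => cu; apply/orP; right; apply/(Mo d dk); exists u; split=> //.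
  move: iu; rewrite /add_leaf /= (negPf uN') andbF orbF => /orP[/and3P[]//|/andP[/eqP E]].
  by rewrite E ltnn in iN.
exists ws; split=> // w /wP[tw wN wu']; have /and3P[w3 w14 _] := tw.
have wN' : w < gn (pg P) := leq_trans w14 N14.
split=> //; first by rewrite add_leaf_col.
move=> u _; rewrite add_leaf_adj //.
  by case/andP; apply: wu'.
by rewrite neq_ltn (leq_trans i4 w3) orbT.
Qed.

Lemma vmodels_leaf_twig P v c i a : framed P -> i < 4 -> twig v i ->
  col P i = None -> vmodels P i a ->
  vmodels (add_leaf P v c) i (None, a.1.2, a.2.-1).
Proof.
move=> F i4 tv iNone [_ /(_ iNone)[Mo [ws [wu wm wP]]]]; have N14 := framed_size F.
have iN : i < gn (pg P) by apply: leq_trans i4 (leq_trans _ N14).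
have /and3P[v3 v14 _] := tv.
have iv : i != v by rewrite neq_ltn (leq_trans i4 v3).
split; rewrite add_leaf_col // => _; split=> [d dk|].
  rewrite (Mo d dk); split=> -[u [u3 uN iu cu]].
    exists u; rewrite add_leaf_size ltnS (ltnW uN); split=> //.
      by rewrite add_leaf_adj // uN.
    by rewrite add_leaf_col.
  rewrite add_leaf_adj // in iu.
  by case/andP: iu => uN' iu; rewrite add_leaf_col // in cu; exists u.
exists (rem v ws); split; first exact: rem_uniq.
  have [vws|vws] := boolP (v \in ws).
    by rewrite size_rem // -!subn1 leq_sub2r.
  by rewrite rem_id //; apply: leq_trans wm; apply: leq_pred.
move=> w; rewrite mem_rem_uniq // inE => /andP[wv /wP[tw wN wu']].
have /and3P[_ w14 _] := tw; have wN' : w < gn (pg P) := leq_trans w14 N14.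
split=> //; first by rewrite add_leaf_col.
move=> u _; rewrite add_leaf_adj //.
by case/andP; apply: wu'.
Qed.

Lemma models_hue P s i : models P s -> i < 4 -> hue s i = col P i.
Proof. by case=> _ M /M[]. Qed.

Lemma lt4_size P i : framed P -> i < 4 -> i < gn (pg P).
Proof. by move=> F i4; apply: leq_trans i4 (leq_trans _ (framed_size F)). Qed.

Lemma viewP P s i c : models P s -> i < 4 -> col P i = None -> c < k ->
  reflect (exists u, [/\ u < gn (pg P), gadj (pg P) i u & col P u = Some c])
          (c \in view s i).
Proof.
move=> M i4 iN ck; have [F Mi] := M; have [_ /(_ iN)[Mo _]] := Mi i i4.
have spine u : u < 4 -> gadj (pg P) i u = consec i u.
  by move=> u4; rewrite (framed_adj F) ?spine_adj //; apply: leq_trans (_ : _ < 4) _.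
rewrite mem_cat; apply: (iffP orP) => [[/(Mo c ck)[u [_ ? ? ?]]|]|[u [uN iu cu]]].
- by exists u.
- rewrite mem_pmap => /mapP[u]; rewrite mem_iota add0n => /andP[_ u4].
  case cu : (consec i u) => // E; exists u; rewrite spine // -(models_hue M u4) -E.
  by split=> //; apply: lt4_size F u4.
- have [u4|u4] := ltnP u 4; last by left; apply/(Mo c ck); exists u.
  right; rewrite mem_pmap; apply/mapP; exists u; first by rewrite mem_iota.
  by rewrite -spine // iu (models_hue M u4) cu.
Qed.

Lemma stuckb_sound P s : models P s -> stuckb s -> stuck k P.
Proof.
move=> M /hasP[i]; rewrite mem_iota add0n => /andP[_ i4] /andP[/eqP iN /allP sees].
have iN' : col P i = None by rewrite -(models_hue M i4).
exists i; split=> //; first exact: lt4_size (proj1 M) i4.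
move=> c [ck leg]; have : c \in view s i by apply: sees; rewrite mem_iota.
by case/(viewP M i4 iN' ck) => u [uN iu]; apply: leg.
Qed.

Lemma play_sound P s m : models P s -> playable s m ->
  exists2 P', color_move k P P' & models P' (play s m).
Proof.
move=> M; case: m => [[b i] c] /= /and4P[i4 ck /eqP iN]; have [F Mi] := M.
have iN' : col P i = None by rewrite -(models_hue M i4).
case: b => [/andP[m0 _]|cv]; last first.
  exists (set_col P i c).
    exists i, c; split=> //; first exact: lt4_size F i4.
    by split=> // u uN iu cu; case/(viewP M i4 iN' ck): cv; exists u.
  apply: models_put M (framed_color _ _ F) _ _.
    by split; rewrite /= eqxx.
  move=> j j4 ji; apply: vmodels_color_far => //.
  - exact: leq_trans i4 _.
  - by rewrite eq_sym.
  - by rewrite /twig leqNgt i4.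
have [_ /(_ iN')[_ [ws [wu wm wP]]]] := Mi i i4.
have [w ww] : exists w, w \in ws.
  by case: (ws) wm m0 => [|w ? ? ?]; [rewrite leqn0 => /eqP E; rewrite /spare E|exists w; rewrite mem_head].
have [tw wN wadj] := wP w ww; have /and3P[w3 w14 /eqP sw] := tw.
exists (set_col P w c).
  exists w, c; split=> //; first exact: leq_trans w14 (framed_size F).
  by split=> // u uN /(wadj u uN) ->; rewrite iN'.
apply: models_put M (framed_color _ _ F) _ _.
  by apply: vmodels_color_twig (Mi i i4) _ _ => //; left.
move=> j j4 ji; apply: vmodels_color_far => //.
- by rewrite neq_ltn (leq_trans j4 w3) orbT.
- by rewrite /twig w3 w14 sw eq_sym.
Qed.

Lemma mem_active s i t : i < 4 -> hue s i = None ->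
  (exists2 c, c < k & c \notin view s i /\ t = put s i (Some c, [::], 0)) \/
  (exists2 c, c < k & c \notin outer s i /\
     (t = put s i (None, c :: outer s i, (spare s i).-1) \/
      t = put s i (None, c :: outer s i, spare s i))) ->
  t \in active_options s.
Proof.
move=> i4 iN H; apply/flattenP.
eexists; first by apply/mapP; exists i; [rewrite mem_iota|reflexivity].
rewrite iN eqxx mem_cat; apply/orP; case: H => -[c ck [cv H]].
  left; rewrite H; apply/mapP; exists c => //.
  by rewrite mem_filter cv mem_iota.
right; apply/flattenP; eexists.
  by apply/mapP; exists c; [rewrite mem_filter cv mem_iota|reflexivity].
by rewrite !inE; case: H => ->; rewrite eqxx ?orbT.
Qed.

Lemma twig_stem v : 3 < v -> v < 14 -> twig v (stem v) /\ stem v < 4.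
Proof.
move=> v3 v14; rewrite /twig v3 v14 eqxx; split=> //.
by move: v v3 v14; do 14?[case=> //].
Qed.

(* In the last alternative the leaf added by Alice hangs from a leaf [v] of
   Tprime; the abstraction discards [v], but Bob may still color it. *)
Lemma alice_sound P s P' : models P s -> ecg_alice_move k P P' ->
  [\/ models P' s, exists2 t, t \in active_options s & models P' t,
      exists i c, [/\ i < 4, hue s i = None, c \in outer s i & models P' (block s i)] |
      exists i v c, [/\ i < 4, hue s i = None, twig v i, P' = add_leaf P v c &
                       models P' (block s i)]].
Proof.
move=> M; have [F Mi] := M; have N14 := framed_size F.
case=> [[v [c [vN vNone [ck leg] ->]]]|[->|[v [c [vN ck ->]]]]]; last first.
- have F' := framed_leaf v c F.
  have [v4|v4] := ltnP v 4.
    have vt i : ~~ twig v i by rewrite /twig leqNgt v4.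
    have far j : j < 4 -> j != v -> vmodels P j (nth vs0 s j) ->
        vmodels (add_leaf P v c) j (nth vs0 s j).
      by move=> j4 jv; apply: vmodels_leaf_far; rewrite // eq_sym.
    case vC : (col P v) => [d|].
      constructor 1; split=> // j j4; have [->|jv] := eqVneq j v.
        by apply: vmodels_leaf_colored => //; [rewrite vC|apply: Mi].
      by apply: far => //; apply: Mi.
    have hv : hue s v = None by rewrite (models_hue M v4).
    have [cO|cO] := boolP (c \in outer s v).
      constructor 1; split=> // j j4; have [->|jv] := eqVneq j v.
        have := Mi v v4; case E : (nth vs0 s v) => [[h S] m] Mv.
        have -> : h = None by have := hv; rewrite /hue E.
        apply: (vmodels_leaf_self (a := (h, S, m))) => // d.
        by have := cO; rewrite /outer E /=; case: eqP => // ->.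
      by apply: far => //; apply: Mi.
    constructor 2; exists (put s v (None, c :: outer s v, spare s v)).
      by apply: (mem_active v4 hv); right; exists c => //; split=> //; right.
    apply: models_put M F' _ _ => [|j j4 jv]; last exact: far.
    by apply: vmodels_leaf_self => //; apply: Mi.
  have [v14|v14] := ltnP v 14; last first.
    constructor 1; split=> // j j4; apply: vmodels_leaf_far => //; last exact: Mi.
      by rewrite neq_ltn (leq_trans j4 v4) orbT.
    by rewrite /twig [v < 14]ltnNge v14 andbF.
  have [tv i4] := twig_stem v4 v14; set i := stem v in tv i4.
  have far j : j < 4 -> j != i -> vmodels P j (nth vs0 s j) ->
      vmodels (add_leaf P v c) j (nth vs0 s j).
    move=> j4 ji; apply: vmodels_leaf_far => //.
      by rewrite neq_ltn (leq_trans j4 v4) orbT.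
    by rewrite /twig v4 v14 eq_sym.
  case iC : (col P i) => [d|].
    constructor 1; split=> // j j4; have [->|ji] := eqVneq j i.
      by apply: vmodels_leaf_colored; [exact: lt4_size F i4|rewrite iC|apply: Mi].
    by apply: far => //; apply: Mi.
  constructor 4; exists i, v, c; split=> //; first by rewrite (models_hue M i4).
  apply: models_put M F' _ _ => [|j j4 ji]; last exact: far.
  by apply: vmodels_leaf_twig => //; apply: Mi.
- by constructor 1.
have F' := framed_color v c F.
have v14 : v < 14.
  by rewrite ltnNge; apply/negP => v14; apply: (framed_new F v14 vN).
have [v4|v4] := ltnP v 4.
  have hv : hue s v = None by rewrite (models_hue M v4).
  constructor 2; exists (put s v (Some c, [::], 0)).
    apply: (mem_active v4 hv); left; exists c => //; split=> //.
    by apply/negP => /(viewP M v4 vNone ck)[u [uN vu]]; apply: leg.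
  apply: models_put M F' _ _ => [|j j4 jv]; first by split; rewrite /= eqxx.
  by apply: vmodels_color_far; rewrite 1?eq_sym // /twig leqNgt v4.
have [tv i4] := twig_stem v4 v14; set i := stem v in tv i4.
have far j : j < 4 -> j != i -> vmodels P j (nth vs0 s j) ->
    vmodels (set_col P v c) j (nth vs0 s j).
  move=> j4 ji; apply: vmodels_color_far => //.
    by rewrite neq_ltn (leq_trans j4 v4) orbT.
  by rewrite /twig v4 v14 eq_sym.
case iC : (col P i) => [d|].
  constructor 1; split=> // j j4; have [->|ji] := eqVneq j i.
    apply: vmodels_colored; [|by rewrite iC|exact: Mi].
    by rewrite neq_ltn (leq_trans i4 v4) orbT.
  by apply: far => //; apply: Mi.
have hi : hue s i = None by rewrite (models_hue M i4).
(* A leaf given a color that [i] already sees costs Bob a spare leaf and has no other effect. *)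
have [cO|cO] := boolP (c \in outer s i).
  constructor 3; exists i, c; split=> //.
  apply: models_put M F' _ _ => [|j j4 ji]; last exact: far.
  apply: vmodels_color_twig (Mi i i4) _ _ => //; last by left.
  by move=> d; case: eqP => // ->.
constructor 2; exists (put s i (None, c :: outer s i, (spare s i).-1)).
  by apply: (mem_active i4 hi); right; exists c => //; split=> //; left.
apply: models_put M F' _ _ => [|j j4 ji]; last exact: far.
by apply: vmodels_color_twig (Mi i i4) _ _ => //; left.
Qed.

Lemma open_sound P s : models P s -> open s -> ~ all_colored P.
Proof.
move=> M /hasP[i]; rewrite mem_iota add0n => /andP[_ i4] /eqP iN ac.
by apply: (ac i); rewrite ?(lt4_size (proj1 M)) // -(models_hue M i4).
Qed.

Lemma color_move_open P P' : color_move k P P' -> ~ all_colored P.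
Proof. by case=> v [c [vN vNone _ _]] ac; apply: ac vNone. Qed.

Lemma alice_options_sound P s : models P s -> open s ->
  (forall t P', t \in alice_options s -> models P' t -> bob_wins_ecg k P' false) ->
  bob_wins_ecg k P true.
Proof.
move=> M op good; apply: bwe_alice (open_sound M op) _ => P' amv.
have blocked i : i < 4 -> hue s i = None -> block s i \in alice_options s.
  move=> i4 iN; rewrite mem_cat inE; apply/orP; right; apply/orP; right.
  by apply: map_f; rewrite mem_filter iN mem_iota.
case: (alice_sound M amv) => [M'|[t tA M']|[i [c [i4 iN _ M']]]|[i [v [c [i4 iN _ _ M']]]]];
  apply: good M'.
- by rewrite mem_cat inE eqxx orbT.
- by rewrite mem_cat tA.
- exact: blocked.
- exact: blocked.
Qed.

Lemma bob_search_sound d P s : bob_search d s -> models P s -> bob_wins_ecg k P false.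
Proof.
elim: d P s => [|d IH] P s /=.
  case st : (stuckb s); first by move=> _ M; apply: bwe_stuck; apply: stuckb_sound M st.
  rewrite find_trueE => /hasP[m _]; case pl : (playable s m) => // st' M.
  have [P' mv M'] := play_sound M pl.
  apply: bwe_bob (color_move_open mv) mv _.
  by apply: bwe_stuck; apply: stuckb_sound M' st'.
case pre : (bob_search d s); first by move=> _; apply: IH.
rewrite find_trueE => /hasP[m _]; case pl : (playable s m) => //.
case op : (open _) => //; rewrite find_falseE => /allP good M.
have [P' mv M'] := play_sound M pl.
apply: bwe_bob (color_move_open mv) mv _.
by apply: alice_options_sound M' op _ => t P'' /good; apply: IH.
Qed.

Lemma bob_ready_sound d P s : bob_ready d s -> models P s -> bob_wins_ecg k P true.
Proof.
rewrite /bob_ready; case op : (open s) => //; rewrite find_falseE => /allP good M.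
by apply: alice_options_sound M op _ => t P' /good; apply: bob_search_sound.
Qed.

Lemma bob_play_sound d P s m : playable s m -> bob_ready d (play s m) ->
  models P s -> bob_wins_ecg k P false.
Proof.
move=> pl rd M; have [P' mv M'] := play_sound M pl.
by apply: bwe_bob (color_move_open mv) mv _; apply: bob_ready_sound rd M'.
Qed.

End Abstract.

(** * Bob's win from the uncolored tree *)

Definition start : seq vstate :=
  [:: (None, [::], 3); (None, [::], 2); (None, [::], 2); (None, [::], 3)].

Lemma start_models k : models k (uncolored Tprime) start.
Proof.
have F : framed (uncolored Tprime).
  by split=> // v v14 /leq_trans/(_ v14); rewrite ltnn.
split=> // i i4; split; first by move: i i4; do 4?[case=> //].
move=> _; split=> [c ck|].
  by split=> [|[u []]] //; move: i i4; do 4?[case=> //].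
exists [seq w <- iota 4 10 | twig w i]; split.
- by rewrite filter_uniq ?iota_uniq.
- by move: i i4; do 4?[case=> //].
- move=> w; rewrite mem_filter mem_iota => /andP[tw w14]; split=> // u uN.
  by rewrite (twig_adj w14 uN) => /and3P[_ _ /eqP <-]; have /and3P[_ _ /eqP] := tw.
Qed.

(** Bob opens on a leaf of an end of the spine. Two colors are certified because a leaf hung by
    Alice may forbid one of them. *)
Lemma Tprime_ready_hit :
  all (fun i => all (fun d => bob_ready 3 3 (play start (true, i, d))) [:: 0; 1]) [:: 0; 3].
Proof. by vm_cast_no_check (erefl true). Qed.

(** When Alice spoils a leaf of an inner spine vertex, Bob colors a leaf of the neighboring end. *)
Lemma Tprime_ready_block1 : bob_ready 3 3 (play (block start 1) (true, 0, 0)).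
Proof. by vm_cast_no_check (erefl true). Qed.

Lemma Tprime_ready_block2 : bob_ready 3 3 (play (block start 2) (true, 3, 0)).
Proof. by vm_cast_no_check (erefl true). Qed.

Lemma Tprime_search_active : all (bob_search 3 2) (active_options 3 start).
Proof. by vm_cast_no_check (erefl true). Qed.

(* Alice has spoiled a leaf of an end of the spine: Bob colors it at once,
   avoiding the color [c] that she blocked. *)
Lemma Tprime_blocked_twig i v c : i \in [:: 0; 3] -> twig v i ->
  bob_wins_ecg 3 (add_leaf (uncolored Tprime) v c) false.
Proof.
move=> i03 tv; set P := add_leaf _ v c.
have i4 : i < 4 by move: i03; rewrite !inE => /orP[]/eqP->.
have [d d01 dc] : exists2 d, d \in [:: 0; 1] & d != c.
  by case: c {P} => [|c]; [exists 1|exists 0].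
have d3 : d < 3 by move: d01; rewrite !inE => /orP[]/eqP->.
have /and3P[v3 v14 /eqP sv] := tv.
have [F Mi] := start_models 3; have F' := framed_leaf v c F.
have vNone : col P v = None by rewrite /P add_leaf_col.
have iNone : col P i = None by rewrite /P add_leaf_col //; apply: leq_trans i4 _.
have mv : color_move 3 P (set_col P v d).
  exists v, d; split=> //; first exact: ltnW.
  split=> // u _ _; rewrite /P /add_leaf /=; case: eqP => // _ [E].
  by rewrite E eqxx in dc.
have M' : models 3 (set_col P v d) (play start (true, i, d)).
  apply: (models_put (P := uncolored Tprime)) (start_models 3) (framed_color _ _ F') _ _.
    (* Alice's move takes [v] out of the spare leaves; coloring it then costs no other one, since
       vertex 14 is a second neighbor. The result is as if she had passed and Bob had colored a
       fresh leaf. *)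
    have Ml := vmodels_leaf_twig c F i4 tv (erefl _) (Mi i i4).
    apply: (vmodels_color_twig F' i4 tv vNone iNone Ml) => //; right; split=> //.
    exists 14; split=> //; first by rewrite /P /add_leaf /= !eqxx !orbT.
    by move=> E; rewrite -E in i4.
  have far j : j < 4 -> j != i -> v != j /\ ~~ twig v j.
    by move=> j4 ji; rewrite neq_ltn (leq_trans j4 v3) orbT /twig v3 v14 sv eq_sym.
  move=> j j4 ji M; have [vj tj] := far j j4 ji.
  by apply: vmodels_color_far => //; apply: vmodels_leaf_far.
apply: bwe_bob (color_move_open mv) mv _; apply: bob_ready_sound M'.
exact: (allP (allP Tprime_ready_hit i i03) d d01).
Qed.

Lemma Tprime_bob_wins3 : bob_wins_ecg 3 (uncolored Tprime) true.
Proof.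
have M := start_models 3; have op : open start by [].
apply: bwe_alice (open_sound M op) _ => P' amv.
case: (alice_sound M amv) => [M'|[t tA M']|[i [c [i4 _]]]|[i [v [c [i4 _ tv E M']]]]].
- have rd := allP (allP Tprime_ready_hit 0 isT) 0 isT.
  exact: (bob_play_sound (k := 3) (s := start) (m := (true, 0, 0)) isT rd M').
- apply: (bob_search_sound _ M'); exact: (allP Tprime_search_active t tA).
- by move: i i4; do 4?[case=> //].
case: i i4 tv M' => [|[|[|[|i]]]] i4 tv M'.
- by rewrite E; apply: Tprime_blocked_twig tv.
- exact: (bob_play_sound (k := 3) (s := block start 1) (m := (true, 0, 0)) isT Tprime_ready_block1 M').
- exact: (bob_play_sound (k := 3) (s := block start 2) (m := (true, 3, 0)) isT Tprime_ready_block2 M').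
- by rewrite E; apply: Tprime_blocked_twig tv.
- by [].
Qed.

Lemma Tprime_bob_wins k : k < 4 -> bob_wins_ecg k (uncolored Tprime) true.
Proof.
case: k => [|[|[|[|//]]]] _; last exact: Tprime_bob_wins3.
- by apply: bwe_stuck; apply: stuckb_sound (start_models 0) _.
- by apply: (@bob_ready_sound 1 0) (start_models 1); vm_compute.
- by apply: (@bob_ready_sound 2 1) (start_models 2); vm_compute.
Qed.

(** Alice's moves in the ordinary game are among those of the expanded game, so Bob's strategy
    carries over. *)
Lemma not_alice_wins k P b : bob_wins_ecg k P b -> ~ alice_wins k P b.
Proof.
elim=> {P b} [P t st|P nc _ IH|P P' nc mv _ IH] aw.
- case: aw st => // {}P {}t ac [v [vN vNone _]]; exact: ac vN vNone.
- by inversion aw; subst; [|apply: (IH P'); [left|]].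
- by inversion aw; subst => //; apply: IH; auto.
Qed.

(** * Four colors on Tprime *)

Section TprimeFourColors.

Notation T := (gadj Tprime).
Notation seen4 := (seen 4 T).

Lemma Tprime_sym (x y : 'I_14) : T x y = T y x.
Proof. by rewrite /= orbC. Qed.

Lemma Tprime_girth (x y z t : 'I_14) : T x y -> T y z ->
  T x z = false /\ (x != z -> y != t -> T z t -> T t x = false).
Proof.
pose nbrs x := [seq y <- iota 0 14 | T x y].
have : all (fun x => all (fun y => all (fun z =>
    ~~ T x z && ((x == z) || all (fun t => (y == t) || ~~ T t x) (nbrs z)))
    (nbrs y)) (nbrs x)) (iota 0 14) by vm_compute.
have in14 (u : 'I_14) : val u \in iota 0 14 by rewrite mem_iota ltn_ord.
have nbr (u w : 'I_14) : T u w -> val w \in nbrs u by rewrite mem_filter in14 andbT.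
move=> /allP/(_ _ (in14 x))/allP H /nbr/H{H}/allP H /nbr/H{H}/andP[/negPf xz H]; split=> // nxz nyt zt.
move: H; rewrite (negPf nxz : (val x == val z) = false) => /allP/(_ _ (nbr _ _ zt)).
by rewrite (negPf nyt : (val y == val t) = false) => /negPf.
Qed.

Lemma Tprime_low_degree (f : nat -> option nat) (x : 'I_14) : 3 < x -> pot 4 T f x < 4.
Proof.
move=> x3; have ex : extends 14 (fun _ => None) f by [].
apply: leq_ltn_trans (pot_extends T (isT : 2 < 4) x ex) _.
rewrite /pot (_ : seen _ _ _ _ = set0) ?cards0; last first.
  by apply/eqP/set0Pn => -[c /seenP[]].
have x14 := ltn_ord x; have Ex u : u < 14 -> T x u = twig x u.
  by move=> u14; rewrite (twig_adj _ u14) ?x3.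
have x0 : stem x < 14 by apply: ltn_trans (proj2 (twig_stem x3 x14)) _.
have sub : free T (fun _ => None) x \subset [set Ordinal x0].
  apply/subsetP => u; rewrite inE Ex // => /andP[/and3P[_ _ /eqP E] _].
  by rewrite inE; apply/eqP/val_inj.
by have := subset_leq_card sub; rewrite cards1; case: #|_| => [|[]].
Qed.

(* Once the two inner spine vertices are colored, only the ends 0 and 3 can be
   dangerous, and they lie in different components. *)
Lemma Tprime_Inv4 f : f 1 <> None -> f 2 <> None ->
  (forall x : 'I_14, (val x == 0) || (val x == 3) -> #|seen4 f x| <= 2) -> Inv 14 4 T f.
Proof.
move=> f1 f2 few.
have ends x : x \in danger 14 4 T f -> (val x == 0) || (val x == 3).
  rewrite inE => /andP[/eqP fx px]; have [x4|x4] := ltnP 3 x.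
    by move: px; rewrite leqNgt Tprime_low_degree.
  by case: x fx x4 {px} => -[|[|[|[|x]]]] //= *; exfalso; auto.
(* With 1 and 2 colored, an uncolored path from 0 stays among 0 and its leaves, where [stem] is
   0. *)
have side (x y : 'I_14) : conn T f x y -> val x == 0 -> val y != 3.
  move=> /connectP[p pp ->] {y} x0.
  have : stem x == 0 by rewrite (eqP x0).
  elim: p x pp {x0} => [|w p IH] x /= => [_|/andP[/and3P[xw /eqP fx /eqP fw] pp]] sx.
    by apply: contraTneq sx => ->.
  apply: IH pp _; move: fx fw xw sx.
  case: x => [x xlt]; case: w => [w wlt] /=.
  by do 14?[case: x xlt => [|x] xlt //]; do 14?[case: w wlt => [|w] wlt //].
have one (x y : 'I_14) : x \in danger 14 4 T f -> y \in danger 14 4 T f -> conn T f x y -> x = y.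
  move=> /ends/orP[]/eqP x0 /ends/orP[]/eqP y0 c; apply: val_inj; rewrite /= x0 y0 //.
    by have := side _ _ c; rewrite x0 y0 => /(_ isT).
  by rewrite conn_sym in c; [have := side _ _ c; rewrite x0 y0 => /(_ isT)|apply: Tprime_sym].
have nadj (x y : 'I_14) : x \in danger 14 4 T f -> y \in danger 14 4 T f -> T x y = false.
  by move=> /ends/orP[]/eqP x0 /ends/orP[]/eqP y0; rewrite x0 y0.
split.
- by move=> x /ends/few.
- by move=> x y z dx dy _ /(one _ _ dx dy) ->; constructor 1.
- by move=> x y dx dy /eqP xy /(one _ _ dx dy).
- by move=> x y dx dy; rewrite nadj.
- by move=> x y t c dx dy; rewrite nadj.
Qed.

(** Alice colors vertex 1, and then vertex 2 unless Bob has just done so, in which case she plays a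
    tempo move. *)
Lemma Tprime_alice_wins4 : alice_wins_game 4 Tprime.
Proof.
have tri (x y z : 'I_14) : T x y -> T y z -> T x z -> False.
  by move=> xy yz; rewrite (proj1 (Tprime_girth x xy yz)).
have sq (x y z t : 'I_14) : T x y -> T y z -> T z t -> T t x -> x != z -> y != t -> False.
  by move=> xy yz zt tx xz yt; have [_ /(_ xz yt zt)] := Tprime_girth t xy yz; rewrite tx.
have wins f : Inv 14 4 T f -> alice_wins 4 (Pos Tprime f) false.
  exact: (Inv_wins (n := 14) (k := 4) isT Tprime_sym tri sq).
pose o1 : 'I_14 := @Ordinal 14 1 isT; pose o2 : 'I_14 := @Ordinal 14 2 isT.
pose f0 : nat -> option nat := fun _ => None; pose f1 := upd f0 1 0.
have s0 (x : 'I_14) : #|seen4 f0 x| = 0 by apply/eqP; rewrite cards_eq0; apply/set0Pn => -[c /seenP[]].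
have s1 (x : 'I_14) : #|seen4 f1 x| <= 1.
  by apply: leq_trans (card_seen_upd T f0 o1 (@Ordinal 4 0 isT) x) _; rewrite s0.
have s2 (v : 'I_14) (c : 'I_4) (x : 'I_14) : #|seen4 (upd f1 v c) x| <= 2.
  by apply: leq_trans (card_seen_upd T f1 v c x) _; rewrite ltnS.
apply: (aw_alice (P' := Pos Tprime f1)).
- by apply: (not_stuck (n := 14) (k := 4) (adj := T)) => // d _; rewrite s0.
- by exists 1, 0.
apply: aw_bob; first by apply: (not_stuck (n := 14) (k := 4) (adj := T)) => // d _; apply: leq_ltn_trans (s1 d) _.
move=> _ [v [c [v14 fv [c4 _] ->]]].
pose v' : 'I_14 := Ordinal v14; pose c' : 'I_4 := Ordinal c4; pose f2 := upd f1 v' c'.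
have nstuck : ~ stuck 4 (Pos Tprime f2).
  by apply: (not_stuck (n := 14) (k := 4) (adj := T)) => // d _; apply: leq_ltn_trans (s2 v' c' d) _.
suff [x [a [fx ax I]]] : exists (x : 'I_14) (a : 'I_4),
    [/\ f2 x = None, a \notin seen4 f2 x & Inv 14 4 T (upd f2 x a)].
  apply: (aw_alice (P' := Pos Tprime (upd f2 x a))) => //; last exact: wins.
  by exists x, a; split=> //; apply: unseen_legal.
have [E|v2] := eqVneq v 2.
  apply: tempo => //; first by apply: Tprime_sym.
    by apply: Tprime_Inv4 => [||x _]; [rewrite /f2 /upd /= E|rewrite /f2 /upd /= E|exact: s2].
  by exists (@Ordinal 14 0 isT); rewrite /f2 /upd /= E.
have f22 : f2 o2 = None by rewrite /f2 /upd /= eq_sym (negPf v2).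
have [a aP] : exists a : 'I_4, a \notin seen4 f2 o2.
  by apply: exists_unseen => //; apply: leq_ltn_trans (s2 v' c' o2) _.
exists o2, a; split=> //; apply: Tprime_Inv4.
- by rewrite /f2 /upd /=; case: eqP.
- by [].
(* Three vertices are colored, but 0 is not adjacent to 2 and 3 is not adjacent to 1, so each end
   sees at most two colors. *)
- move=> x /orP[]/eqP x0.
    by rewrite seen_upd_nadj ?x0 //; apply: s2.
  apply: leq_trans (card_seen_upd _ _ _ _ _) _; rewrite ltnS.
  apply: leq_trans (card_seen_upd _ _ _ _ _) _; rewrite ltnS.
  by rewrite (seen_upd_nadj (v := o1) _ (@Ordinal 4 0 isT)) ?s0 //= x0.
Qed.

End TprimeFourColors.

Theorem theorem5p7 :
  bob_wins_ecg 3 (uncolored Tprime) true /\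
  game_chromatic_eq Tprime 4 /\
  (forall G : graph, is_forest G -> gn G < 14 -> game_chromatic_le G 3).
Proof.
split; first exact: Tprime_bob_wins3.
split; first split.
- exact: Tprime_alice_wins4.
- by move=> s s4; apply: not_alice_wins; apply: Tprime_bob_wins.
- by move=> G fG G14; exists 3; split=> //; apply: small_forest_alice_wins.
Qed.
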